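(* Let $\mathbb K$ be a field, let $f:\mathbb N^k\to\mathbb N^\ell$ be a surjective monoid homomorphism, and let $\Gamma$ be a row-finite $\ell$-graph with no sources and a finite nonempty set of vertices, which is cofinal and aperiodic. Put $A=\mathrm{KP}_{\mathbb K}(f^*\Gamma)$, $H=\ker\bar f$, $C=\mathbb K[H]$, and for an ideal $J$ of $C$ put $I_J=A\,\iota(J)=\iota(J)A$. Then the map $$\mathcal L(C)\longrightarrow\mathcal L(A),\qquad J\longmapsto I_J,$$ is a lattice isomorphism from the lattice of ideals of $C$ to the lattice of two-sided ideals of $A$, with inverse $$I\longmapsto\iota^{-1}(I\cap\iota(C)).$$ Moreover, for every proper ideal $J$ of $C$ there is an isomorphism $$A/I_J\cong\mathrm{KP}_{C/J}(\Gamma).$$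
   Context: $\mathbb N$ contains $0$. A $k$-graph is a countable small category $\Lambda$ with a functor $d:\Lambda\to\mathbb N^k$ satisfying the factorisation property: if $d(\lambda)=m+n$ there are unique composable $\mu,\nu$ with $\lambda=\mu\nu$, $d(\mu)=m$, $d(\nu)=n$. Objects are identified with $\Lambda^0=d^{-1}(0)$ (vertices); $r,s$ are range and source, and $\mu\nu$ is defined when $s(\mu)=r(\nu)$. Put $v\Lambda^n=\{\lambda: d(\lambda)=n,\ r(\lambda)=v\}$ and $v\Lambda w=\{\lambda:r(\lambda)=v,\ s(\lambda)=w\}$. $\Lambda$ is row-finite if every $v\Lambda^n$ is finite, and has no sources if every $v\Lambda^n$ is nonempty. For a commutative unital ring $R$ and a row-finite $k$-graph $\Lambda$ with no sources, $\mathrm{KP}_R(\Lambda)$ is the universal $R$-algebra generated by $\{p_v:v\in\Lambda^0\}\cup\{s_\lambda,s_{\lambda^*}:\lambda\in\Lambda\setminus\Lambda^0\}$, with $s_v=s_{v^*}=p_v$, subject to: (KP1) the $p_v$ are mutually orthogonal idempotents; (KP2) $s_\lambda s_\mu=s_{\lambda\mu}$ and $s_{\mu^*}s_{\lambda^*}=s_{(\lambda\mu)^*}$ whenever $\lambda\mu$ is defined, and $p_{r(\lambda)}s_\lambda=s_\lambda=s_\lambda p_{s(\lambda)}$, $p_{s(\lambda)}s_{\lambda^*}=s_{\lambda^*}=s_{\lambda^*}p_{r(\lambda)}$; (KP3) if $d(\lambda)=d(\mu)$ then $s_{\lambda^*}s_\mu=\delta_{\lambda,\mu}p_{s(\lambda)}$;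 (KP4) $p_v=\sum_{\lambda\in v\Lambda^n}s_\lambda s_{\lambda^*}$ for $v\in\Lambda^0$, $0\ne n\in\mathbb N^k$. It is unital, with $1=\sum_v p_v$, when $\Lambda^0$ is finite. Infinite paths: $\Gamma^\infty$ is the set of degree-preserving functors $x:\{(p,q):p\le q\in\mathbb N^\ell\}\to\Gamma$ (with $d(x(p,q))=q-p$); $x(n)=x(n,n)$, $v\Gamma^\infty=\{x:x(0)=v\}$, $(\sigma^mx)(p,q)=x(p+m,q+m)$. $\Gamma$ is cofinal if for every $v\in\Gamma^0$ and $x\in\Gamma^\infty$ there is $n\in\mathbb N^\ell$ with $v\Gamma x(n)\ne\varnothing$. $\Gamma$ is aperiodic if for every $v\in\Gamma^0$ there is $x\in v\Gamma^\infty$ with $\sigma^mx\ne\sigma^nx$ whenever $m\ne n$. Pullback: $f^*\Gamma=\{(\lambda,n)\in\Gamma\times\mathbb N^k:d(\lambda)=f(n)\}$, a $k$-graph with degree $d(\lambda,n)=n$ and product $(\lambda,n)(\mu,m)=(\lambda\mu,n+m)$; vertices $(v,0)$ are identified with $v\in\Gamma^0$. $\bar f:\mathbb Z^k\to\mathbb Z^\ell$ is the group completion of $f$. $\mathbb K[H]$ is the group algebra with basis $u_h$ ($h\in H$), $u_hu_g=u_{h+g}$. For $h\in H$ write $h=h_+-h_-$ (coordinatewise positive and negative parts) and put $U_h=\sum_{v\in\Gamma^0}\sum_{\lambda\in v\Gamma^{f(h_+)}}s_{(\lambda,h_+)}s_{(\lambda,h_-)^*}\in A$ (note $f(h_+)=f(h_-)$).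 The map $\iota:\mathbb K[H]\to A$, $u_h\mapsto U_h$, is an injective unital homomorphism with central image. *)

(* Defs.v *)
From HB Require Import structures.
From mathcomp Require Import all_boot all_order all_algebra ring_quotient.
From mathcomp Require Import boolp classical_sets cardinality fsbigop.
From mathcomp Require Import finmap monalg zify.

Set Implicit Arguments.
Unset Strict Implicit.
Unset Printing Implicit Defensive.

Import Order.TTheory GRing.Theory Num.Theory.

Local Open Scope ring_scope.
Local Open Scope quotient_scope.

Notation natvec k := {ffun 'I_k -> nat}.
Notation zvec k := {ffun 'I_k -> int}.

(* A k-graph with object set V.  Morphisms form the type mor, and
   kcomp m n is the composite mn when src m = rng n; its value on
   non-composable pairs is unconstrained and never used.
   Objects correspond to morphisms of degree 0 via idm (lemma deg0_idm). *)
Record kgraph (k : nat) (V : countType) := KGraph {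
  mor :> countType;
  rng : mor -> V;
  src : mor -> V;
  idm : V -> mor;
  kcomp : mor -> mor -> mor;
  deg : mor -> natvec k;
  rng_idm : forall v, rng (idm v) = v;
  src_idm : forall v, src (idm v) = v;
  rng_comp : forall m n, src m = rng n -> rng (kcomp m n) = rng m;
  src_comp : forall m n, src m = rng n -> src (kcomp m n) = src n;
  comp_idl : forall m, kcomp (idm (rng m)) m = m;
  comp_idr : forall m, kcomp m (idm (src m)) = m;
  comp_assoc : forall l m n, src l = rng m -> src m = rng n ->
    kcomp l (kcomp m n) = kcomp (kcomp l m) n;
  deg_idm : forall v, deg (idm v) = 0;
  deg_comp : forall m n, src m = rng n -> deg (kcomp m n) = deg m + deg n;
  factorisation : forall l a b, deg l = a + b ->
    exists! p : mor * mor,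
      [/\ src p.1 = rng p.2, kcomp p.1 p.2 = l, deg p.1 = a & deg p.2 = b]
}.

Arguments idm {k V _} v.

Section KGraphTheory.
Variables (k : nat) (V : countType) (L : kgraph k V).

Lemma deg0_idm (l : L) : deg l = 0 -> l = idm (rng l).
Proof.
move=> l0; have := @factorisation _ _ L l 0 0; rewrite l0 addr0.
case=> // p [_ up].
have {}up q : [/\ src q.1 = rng q.2, kcomp q.1 q.2 = l, deg q.1 = 0
    & deg q.2 = 0] -> p = q by exact: up.
have e1 : p = (idm (rng l), l).
  by apply: up; rewrite /= src_idm comp_idl deg_idm l0.
have : p = (l, idm (src l)).
  by apply: up; rewrite /= rng_idm comp_idr deg_idm l0.
by rewrite e1 => -[].
Qed.

Definition paths (v : V) (n : natvec k) : set L :=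
  [set l | rng l = v /\ deg l = n].

Definition row_finite := forall v n, finite_set (paths v n).

Definition no_sources := forall v n, (paths v n !=set0)%classic.

End KGraphTheory.

Arguments paths {k V} L v n.

Definition vle k (p q : natvec k) : bool := [forall i, (p i <= q i)%N].

Lemma vle_refl k (p : natvec k) : vle p p.
Proof. exact/forallP. Qed.

Lemma vle_trans k (p q t : natvec k) : vle p q -> vle q t -> vle p t.
Proof.
move=> /forallP pq /forallP qt; apply/forallP => i.
exact: leq_trans (pq i) (qt i).
Qed.

Lemma vle_add2r k (m p q : natvec k) : vle p q -> vle (p + m) (q + m).
Proof.
by move=> /forallP pq; apply/forallP => i; rewrite !ffunE leq_add2r.
Qed.

Section InfinitePaths.
Variables (k : nat) (V : countType) (L : kgraph k V).

(* Degree-preserving functors from the category {(p, q) : p <= q in N^k},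
   in which (p, q) has range p and source q. *)
Record infpath := InfPath {
  ivtx : natvec k -> V;
  imor : forall p q : natvec k, vle p q -> L;
  rng_imor : forall p q (pq : vle p q), rng (imor pq) = ivtx p;
  src_imor : forall p q (pq : vle p q), src (imor pq) = ivtx q;
  imor_id : forall p, imor (vle_refl p) = idm (ivtx p);
  imor_comp : forall p q t (pq : vle p q) (qt : vle q t),
    imor (vle_trans pq qt) = kcomp (imor pq) (imor qt);
  deg_imor : forall p q (pq : vle p q),
    deg (imor pq) = [ffun i => (q i - p i)%N]
}.

Section Shift.
Variables (m : natvec k) (x : infpath).

Let sh p q (pq : vle p q) := imor x (vle_add2r m pq).

Lemma shift_id p : sh (vle_refl p) = idm (ivtx x (p + m)).
Proof. by rewrite -imor_id /sh; congr imor; apply: bool_irrelevance. Qed.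

Lemma shift_comp p q t (pq : vle p q) (qt : vle q t) :
  sh (vle_trans pq qt) = kcomp (sh pq) (sh qt).
Proof. by rewrite -imor_comp /sh; congr imor; apply: bool_irrelevance. Qed.

Lemma shift_deg p q (pq : vle p q) :
  deg (sh pq) = [ffun i => (q i - p i)%N].
Proof. by rewrite deg_imor; apply/ffunP => i; rewrite !ffunE subnDr. Qed.

Definition shift : infpath :=
  @InfPath (fun p => ivtx x (p + m)) (fun p q pq => imor x (vle_add2r m pq))
    (fun p q pq => rng_imor x _) (fun p q pq => src_imor x _)
    shift_id shift_comp shift_deg.

End Shift.

Definition cofinal := forall (v : V) (x : infpath),
  exists (n : natvec k) (l : L), rng l = v /\ src l = ivtx x n.

Definition aperiodic := forall v : V, exists x : infpath,
  ivtx x 0 = v /\ forall m n : natvec k, m <> n -> shift m x <> shift n x.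

End InfinitePaths.

Arguments cofinal {k V} L.
Arguments aperiodic {k V} L.
Arguments row_finite {k V} L.
Arguments no_sources {k V} L.

(* Formal (non-unital) R-algebra expressions in the generators p_v, s_l and
   s_{l^*}.  The generators for l = idm v are redundant and are identified
   with p_v in kpeq. *)
Inductive kpterm (R : comPzRingType) k (V : countType) (L : kgraph k V) :=
| Tp of V
| Ts of L
| Tss of L
| Tzero
| Tadd of kpterm R L & kpterm R L
| Topp of kpterm R L
| Tscale of R & kpterm R L
| Tmul of kpterm R L & kpterm R L.

Arguments Tp {R k V L} v.
Arguments Ts {R k V L} l.
Arguments Tss {R k V L} l.
Arguments Tzero {R k V L}.

HB.instance Definition _ R k V (L : kgraph k V) := gen_eqMixin (kpterm R L).
HB.instance Definition _ R k V (L : kgraph k V) :=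
  gen_choiceMixin (kpterm R L).

Section KumjianPask.
Variables (R : comPzRingType) (k : nat) (V : countType) (L : kgraph k V).
Local Notation T := (kpterm R L).

(* The least congruence on expressions that contains the axioms of
   (associative, not necessarily unital) R-algebras and the Kumjian-Pask
   relations, for row-finite L: then paths L v n is finite and fset_set
   enumerates it in kp4. *)
Inductive kpeq : T -> T -> Prop :=
| kpeq_refl x : kpeq x x
| kpeq_sym x y : kpeq x y -> kpeq y x
| kpeq_trans x y z : kpeq x y -> kpeq y z -> kpeq x z
| kpeq_add x x' y y' :
    kpeq x x' -> kpeq y y' -> kpeq (Tadd x y) (Tadd x' y')
| kpeq_opp x x' : kpeq x x' -> kpeq (Topp x) (Topp x')
| kpeq_scale r x x' : kpeq x x' -> kpeq (Tscale r x) (Tscale r x')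
| kpeq_mul x x' y y' :
    kpeq x x' -> kpeq y y' -> kpeq (Tmul x y) (Tmul x' y')
| kpeq_addA x y z : kpeq (Tadd x (Tadd y z)) (Tadd (Tadd x y) z)
| kpeq_addC x y : kpeq (Tadd x y) (Tadd y x)
| kpeq_add0 x : kpeq (Tadd Tzero x) x
| kpeq_addN x : kpeq (Tadd (Topp x) x) Tzero
| kpeq_scaleA r t x : kpeq (Tscale r (Tscale t x)) (Tscale (r * t) x)
| kpeq_scale1 x : kpeq (Tscale 1 x) x
| kpeq_scaleDr r x y :
    kpeq (Tscale r (Tadd x y)) (Tadd (Tscale r x) (Tscale r y))
| kpeq_scaleDl r t x :
    kpeq (Tscale (r + t) x) (Tadd (Tscale r x) (Tscale t x))
| kpeq_mulA x y z : kpeq (Tmul x (Tmul y z)) (Tmul (Tmul x y) z)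
| kpeq_mulDl x y z :
    kpeq (Tmul (Tadd x y) z) (Tadd (Tmul x z) (Tmul y z))
| kpeq_mulDr x y z :
    kpeq (Tmul x (Tadd y z)) (Tadd (Tmul x y) (Tmul x z))
| kpeq_scaleAl r x y : kpeq (Tscale r (Tmul x y)) (Tmul (Tscale r x) y)
| kpeq_scaleAr r x y : kpeq (Tscale r (Tmul x y)) (Tmul x (Tscale r y))
| kp_s_idm v : kpeq (Ts (idm v)) (Tp v)
| kp_ss_idm v : kpeq (Tss (idm v)) (Tp v)
| kp1_idem v : kpeq (Tmul (Tp v) (Tp v)) (Tp v)
| kp1_orth v w : v <> w -> kpeq (Tmul (Tp v) (Tp w)) Tzero
| kp2_s l m : src l = rng m -> kpeq (Tmul (Ts l) (Ts m)) (Ts (kcomp l m))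
| kp2_ss l m :
    src l = rng m -> kpeq (Tmul (Tss m) (Tss l)) (Tss (kcomp l m))
| kp2_ps l : kpeq (Tmul (Tp (rng l)) (Ts l)) (Ts l)
| kp2_sp l : kpeq (Tmul (Ts l) (Tp (src l))) (Ts l)
| kp2_pss l : kpeq (Tmul (Tp (src l)) (Tss l)) (Tss l)
| kp2_ssp l : kpeq (Tmul (Tss l) (Tp (rng l))) (Tss l)
| kp3_eq l : kpeq (Tmul (Tss l) (Ts l)) (Tp (src l))
| kp3_neq l m : deg l = deg m -> l <> m -> kpeq (Tmul (Tss l) (Ts m)) Tzero
| kp4 v n : n <> 0 ->
    kpeq (Tp v)
      (\big[@Tadd R k V L/Tzero]_(l <- fset_set (paths L v n))
          Tmul (Ts l) (Tss l)).

Definition kpeqb : rel T := fun x y => `[< kpeq x y >].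

Lemma kpeqb_equiv : equiv_class_of kpeqb.
Proof.
split=> [x|x y|y x z]; first exact/asboolP/kpeq_refl.
  by apply/asboolP/asboolP => /kpeq_sym.
by move=> /asboolP xy /asboolP yz; apply/asboolP/(kpeq_trans xy yz).
Qed.

Canonical kpeqb_equivRel := EquivRelPack kpeqb_equiv.
Canonical kpeqb_encModRel := defaultEncModRel kpeqb.

Definition KP := {eq_quot kpeqb}.
HB.instance Definition _ : EqQuotient T kpeqb KP := EqQuotient.on KP.
HB.instance Definition _ := Choice.on KP.

Lemma kp_piP (x y : T) : \pi_KP x = \pi_KP y <-> kpeq x y.
Proof. by split=> [/eqquotP/asboolP|/asboolP xy]; last exact/eqquotP. Qed.

Lemma kp_repr_pi (x : T) : kpeq (repr (\pi_KP x)) x.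
Proof. by apply/kp_piP; rewrite reprK. Qed.

Definition kp_p (v : V) : KP := \pi_KP (Tp v).
Definition kp_s (l : L) : KP := \pi_KP (Ts l).
Definition kp_ss (l : L) : KP := \pi_KP (Tss l).

Definition kp_zero : KP := \pi_KP Tzero.
Definition kp_opp := lift_op1 KP (@Topp R k V L).
Definition kp_add := lift_op2 KP (@Tadd R k V L).
Definition kp_mul := lift_op2 KP (@Tmul R k V L).
Definition kp_scale r := lift_op1 KP (@Tscale R k V L r).

Lemma kp_oppE x : kp_opp (\pi_KP x) = \pi_KP (Topp x).
Proof. unlock kp_opp; exact/kp_piP/kpeq_opp/kp_repr_pi. Qed.
Lemma kp_addE x y : kp_add (\pi_KP x) (\pi_KP y) = \pi_KP (Tadd x y).
Proof. by unlock kp_add; apply/kp_piP/kpeq_add; apply: kp_repr_pi. Qed.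
Lemma kp_mulE x y : kp_mul (\pi_KP x) (\pi_KP y) = \pi_KP (Tmul x y).
Proof. by unlock kp_mul; apply/kp_piP/kpeq_mul; apply: kp_repr_pi. Qed.
Lemma kp_scaleE r x : kp_scale r (\pi_KP x) = \pi_KP (Tscale r x).
Proof. unlock kp_scale; exact/kp_piP/kpeq_scale/kp_repr_pi. Qed.

Let kpE := (kp_oppE, kp_addE, kp_mulE, kp_scaleE).

Lemma kp_addA : associative kp_add.
Proof.
elim/quotW=> x; elim/quotW=> y; elim/quotW=> z; rewrite !kpE.
by apply/kp_piP; exact: kpeq_addA.
Qed.
Lemma kp_addC : commutative kp_add.
Proof.
by elim/quotW=> x; elim/quotW=> y; rewrite !kpE; apply/kp_piP; exact: kpeq_addC.
Qed.
Lemma kp_add0 : left_id kp_zero kp_add.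
Proof. by elim/quotW=> x; rewrite !kpE; apply/kp_piP; exact: kpeq_add0. Qed.
Lemma kp_addN : left_inverse kp_zero kp_opp kp_add.
Proof. by elim/quotW=> x; rewrite !kpE; apply/kp_piP; exact: kpeq_addN. Qed.

HB.instance Definition _ :=
  GRing.isZmodule.Build KP kp_addA kp_addC kp_add0 kp_addN.

Lemma kp_scaleA r t x : kp_scale r (kp_scale t x) = kp_scale (r * t) x.
Proof. by elim/quotW: x => x; rewrite !kpE; apply/kp_piP; exact: kpeq_scaleA. Qed.
Lemma kp_scale1 : left_id 1 kp_scale.
Proof. by elim/quotW=> x; rewrite !kpE; apply/kp_piP; exact: kpeq_scale1. Qed.
Lemma kp_scaleDr : right_distributive kp_scale +%R.
Proof.
move=> r; elim/quotW=> x; elim/quotW=> y; rewrite /GRing.add /= !kpE.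
by apply/kp_piP; exact: kpeq_scaleDr.
Qed.
Lemma kp_scaleDl x : {morph kp_scale^~ x : r t / r + t}.
Proof.
move=> r t; elim/quotW: x => x; rewrite {2}/GRing.add /= !kpE.
by apply/kp_piP; exact: kpeq_scaleDl.
Qed.

HB.instance Definition _ := GRing.Zmodule_isLmodule.Build R KP
  kp_scaleA kp_scale1 kp_scaleDr kp_scaleDl.

Lemma kp_mulA : associative kp_mul.
Proof.
elim/quotW=> x; elim/quotW=> y; elim/quotW=> z; rewrite !kpE.
by apply/kp_piP; exact: kpeq_mulA.
Qed.
Lemma kp_mulDl : left_distributive kp_mul +%R.
Proof.
elim/quotW=> x; elim/quotW=> y; elim/quotW=> z; rewrite /GRing.add /= !kpE.
by apply/kp_piP; exact: kpeq_mulDl.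
Qed.
Lemma kp_mulDr : right_distributive kp_mul +%R.
Proof.
elim/quotW=> x; elim/quotW=> y; elim/quotW=> z; rewrite /GRing.add /= !kpE.
by apply/kp_piP; exact: kpeq_mulDr.
Qed.
Lemma kp_scaleAl r x y : r *: kp_mul x y = kp_mul (r *: x) y.
Proof.
elim/quotW: x => x; elim/quotW: y => y; rewrite /GRing.scale /= !kpE.
by apply/kp_piP; exact: kpeq_scaleAl.
Qed.
Lemma kp_scaleAr r x y : r *: kp_mul x y = kp_mul x (r *: y).
Proof.
elim/quotW: x => x; elim/quotW: y => y; rewrite /GRing.scale /= !kpE.
by apply/kp_piP; exact: kpeq_scaleAr.
Qed.

End KumjianPask.

Arguments kp_p {R k V} L v.
Arguments kp_s {R k V L} l.
Arguments kp_ss {R k V L} l.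
Arguments KP R {k V} L.

(* For finitely many vertices the algebra is unital with 1 = \sum_v p_v.
   MathComp's algType requires 1 != 0, which is not assumed here: KP carries
   the pzRingType and lmodType structures, compatible by kp_scaleAl and
   kp_scaleAr. *)
Section KumjianPaskUnit.
Variables (R : comPzRingType) (k : nat) (V : finType) (L : kgraph k V).
Local Notation A := (KP R L).

Definition kp_one : A := \sum_(v : V) kp_p L v.

Let mul0 (x : A) : kp_mul 0 x = 0.
Proof. by apply: (addrI (kp_mul 0 x)); rewrite -kp_mulDl !addr0. Qed.
Let mulr0_ (x : A) : kp_mul x 0 = 0.
Proof. by apply: (addrI (kp_mul x 0)); rewrite -kp_mulDr !addr0. Qed.
Let mulNl (x y : A) : kp_mul (- x) y = - kp_mul x y.
Proof.
by apply: (addrI (kp_mul x y)); rewrite -kp_mulDl !subrr mul0.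
Qed.
Let mulNr (x y : A) : kp_mul x (- y) = - kp_mul x y.
Proof.
by apply: (addrI (kp_mul x y)); rewrite -kp_mulDr !subrr mulr0_.
Qed.

Let pp v w :
  kp_mul (kp_p L v) (kp_p L w) = if v == w then kp_p L v else 0 :> A.
Proof.
rewrite kp_mulE; case: eqP => [<-|vw]; first by apply/kp_piP; exact: kp1_idem.
by apply/kp_piP; exact: kp1_orth.
Qed.

Let one_p v : kp_mul kp_one (kp_p L v) = kp_p L v.
Proof.
rewrite (big_morph (fun x => kp_mul x _) (fun _ _ => kp_mulDl _ _ _) (mul0 _)).
rewrite (bigD1 v) //= pp eqxx big1 ?addr0 // => w /negbTE wv.
by rewrite pp wv.
Qed.

Let p_one v : kp_mul (kp_p L v) kp_one = kp_p L v.
Proof.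
rewrite (big_morph (kp_mul _) (fun _ _ => kp_mulDr _ _ _) (mulr0_ _)).
rewrite (bigD1 v) //= pp eqxx big1 ?addr0 // => w /negbTE wv.
by rewrite pp eq_sym wv.
Qed.

Lemma kp_mul1 : left_id kp_one (@kp_mul R k V L).
Proof.
elim/quotW; elim=> [v|l|l||x IHx y IHy|x IHx|r x IHx|x IHx y IHy].
- exact: one_p.
- have <- : kp_mul (kp_p L (rng l)) (kp_s l) = \pi_A (Ts l).
    by rewrite kp_mulE; apply/kp_piP; exact: kp2_ps.
  by rewrite kp_mulA one_p.
- have <- : kp_mul (kp_p L (src l)) (kp_ss l) = \pi_A (Tss l).
    by rewrite kp_mulE; apply/kp_piP; exact: kp2_pss.
  by rewrite kp_mulA one_p.
- exact: mulr0_.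
- by rewrite -kp_addE -[kp_add _ _]/(_ + _) kp_mulDr IHx IHy.
- by rewrite -kp_oppE -[kp_opp _]/(- _) mulNr IHx.
- by rewrite -kp_scaleE -[kp_scale r _]/(r *: (\pi_A x : A)) -kp_scaleAr IHx.
- by rewrite -kp_mulE kp_mulA IHx.
Qed.

Lemma kp_mulr1 : right_id kp_one (@kp_mul R k V L).
Proof.
elim/quotW; elim=> [v|l|l||x IHx y IHy|x IHx|r x IHx|x IHx y IHy].
- exact: p_one.
- have <- : kp_mul (kp_s l) (kp_p L (src l)) = \pi_A (Ts l).
    by rewrite kp_mulE; apply/kp_piP; exact: kp2_sp.
  by rewrite -kp_mulA p_one.
- have <- : kp_mul (kp_ss l) (kp_p L (rng l)) = \pi_A (Tss l).
    by rewrite kp_mulE; apply/kp_piP; exact: kp2_ssp.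
  by rewrite -kp_mulA p_one.
- exact: mul0.
- by rewrite -kp_addE -[kp_add _ _]/(_ + _) kp_mulDl IHx IHy.
- by rewrite -kp_oppE -[kp_opp _]/(- _) mulNl IHx.
- by rewrite -kp_scaleE -[kp_scale r _]/(r *: (\pi_A x : A)) -kp_scaleAl IHx.
- by rewrite -kp_mulE -kp_mulA IHy.
Qed.

HB.instance Definition _ := GRing.Zmodule_isPzRing.Build A
  (@kp_mulA R k V L) kp_mul1 kp_mulr1
  (@kp_mulDl R k V L) (@kp_mulDr R k V L).

End KumjianPaskUnit.

Section Pullback.
Variables (k l : nat) (f : {additive natvec k -> natvec l}).
Variables (V : countType) (G : kgraph l V).

Definition pbmor := {p : G * natvec k | deg p.1 == f p.2}.
HB.instance Definition _ := Countable.on pbmor.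

Implicit Types x y z : pbmor.

Definition pb_rng x : V := rng (val x).1.
Definition pb_src x : V := src (val x).1.
Definition pb_deg x : natvec k := (val x).2.

Lemma pb_idm_subproof (v : V) : deg (idm v : G) == f 0.
Proof. by rewrite deg_idm raddf0. Qed.
Definition pb_idm (v : V) : pbmor :=
  exist _ (idm v : G, 0 : natvec k) (pb_idm_subproof v).

(* The default value x is only taken on non-composable pairs. *)
Definition pb_comp x y : pbmor :=
  insubd x (kcomp (val x).1 (val y).1, (val x).2 + (val y).2).

Lemma val_pb_comp x y : pb_src x = pb_rng y ->
  val (pb_comp x y) = (kcomp (val x).1 (val y).1, (val x).2 + (val y).2).
Proof.
move=> xy; rewrite val_insubd /= deg_comp // raddfD.
by rewrite (eqP (valP x)) (eqP (valP y)) eqxx.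
Qed.

Lemma pb_rng_idm v : pb_rng (pb_idm v) = v.
Proof. exact: rng_idm. Qed.
Lemma pb_src_idm v : pb_src (pb_idm v) = v.
Proof. exact: src_idm. Qed.
Lemma pb_rng_comp x y : pb_src x = pb_rng y -> pb_rng (pb_comp x y) = pb_rng x.
Proof. by move=> xy; rewrite /pb_rng val_pb_comp //= rng_comp. Qed.
Lemma pb_src_comp x y : pb_src x = pb_rng y -> pb_src (pb_comp x y) = pb_src y.
Proof. by move=> xy; rewrite /pb_src val_pb_comp //= src_comp. Qed.
Lemma pb_comp_idl x : pb_comp (pb_idm (pb_rng x)) x = x.
Proof.
apply: val_inj; rewrite val_pb_comp ?pb_src_idm //= comp_idl add0r.
by case: x => -[].
Qed.
Lemma pb_comp_idr x : pb_comp x (pb_idm (pb_src x)) = x.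
Proof.
apply: val_inj; rewrite val_pb_comp ?pb_rng_idm //= comp_idr addr0.
by case: x => -[].
Qed.
Lemma pb_comp_assoc x y z : pb_src x = pb_rng y -> pb_src y = pb_rng z ->
  pb_comp x (pb_comp y z) = pb_comp (pb_comp x y) z.
Proof.
move=> xy yz; apply: val_inj.
rewrite !val_pb_comp ?pb_rng_comp ?pb_src_comp //=.
by rewrite comp_assoc // addrA.
Qed.
Lemma pb_deg_idm v : pb_deg (pb_idm v) = 0.
Proof. by []. Qed.
Lemma pb_deg_comp x y :
  pb_src x = pb_rng y -> pb_deg (pb_comp x y) = pb_deg x + pb_deg y.
Proof. by move=> xy; rewrite /pb_deg val_pb_comp. Qed.

Lemma pb_factorisation x a b : pb_deg x = a + b ->
  exists! p : pbmor * pbmor,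
    [/\ pb_src p.1 = pb_rng p.2, pb_comp p.1 p.2 = x,
        pb_deg p.1 = a & pb_deg p.2 = b].
Proof.
move=> xab; have /factorisation : deg (val x).1 = f a + f b.
  by rewrite (eqP (valP x)) -raddfD -xab.
case=> -[m n] [/= [mn cmn dm dn] umn].
have pm : deg m == f a by rewrite dm.
have pn : deg n == f b by rewrite dn.
exists (exist _ (m, a) pm, exist _ (n, b) pn); split=> /=.
  split=> //; apply: val_inj; rewrite val_pb_comp //= cmn -xab /pb_deg.
  by case: (x) => -[].
case=> y z /= [yz cyz dy dz]; move: (congr1 val cyz).
rewrite val_pb_comp //= => e.
have := umn ((val y).1, (val z).1).
rewrite /= (eqP (valP y)) (eqP (valP z)) -/(pb_deg y) -/(pb_deg z) dy dz -e /=.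
move=> /(_ (And4 yz erefl erefl erefl)) [em en].
congr pair; apply: val_inj => /=.
  by rewrite em -dy /pb_deg; case: (y) => -[].
by rewrite en -dz /pb_deg; case: (z) => -[].
Qed.

Definition pullback : kgraph k V :=
  KGraph pb_rng_idm pb_src_idm pb_rng_comp pb_src_comp pb_comp_idl
    pb_comp_idr pb_comp_assoc pb_deg_idm pb_deg_comp pb_factorisation.

End Pullback.

Definition vpos k (h : zvec k) : natvec k := [ffun i => `|Num.max (h i) 0|%N].
Definition vneg k (h : zvec k) : natvec k :=
  [ffun i => `|Num.max (- h i) 0|%N].
Definition vint k (n : natvec k) : zvec k := [ffun i => (n i)%:Z].

Lemma natvec_addE k (p q : natvec k) i : (p + q) i = (p i + q i)%N.
Proof. by rewrite ffunE. Qed.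

Lemma vposnegE k (h : zvec k) : h = vint (vpos h) - vint (vneg h).
Proof.
apply/ffunP => i; rewrite !ffunE; case: (h i) => n.
  by rewrite [Num.max (- _) _]max_r ?oppr_le0 // max_l // subr0.
by rewrite max_r // NegzE opprK max_l // sub0r.
Qed.

Section GroupCompletion.
Variables (k l : nat) (f : {additive natvec k -> natvec l}).

(* The unique group morphism extending f (fbar_is_zmod_morphism,
   fbar_vint). *)
Definition fbar (h : zvec k) : zvec l := vint (f (vpos h)) - vint (f (vneg h)).

Lemma fbarB (m n : natvec k) :
  fbar (vint m - vint n) = vint (f m) - vint (f n).
Proof.
set h := _ - _; have e : vpos h + n = vneg h + m.
  have /ffunP hE := vposnegE h.
  by apply/ffunP => i; move: (hE i); rewrite /h !(natvec_addE, ffunE); lia.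
have /ffunP ef := congr1 f e; apply/ffunP => i.
by move: (ef i); rewrite !raddfD /fbar !(natvec_addE, ffunE); lia.
Qed.

Lemma fbar_is_zmod_morphism : zmod_morphism fbar.
Proof.
move=> g h.
have -> : g - h = vint (vpos g + vneg h) - vint (vneg g + vpos h).
  rewrite {1}(vposnegE g) {1}(vposnegE h).
  by apply/ffunP => i; rewrite !(natvec_addE, ffunE); lia.
by rewrite fbarB !raddfD; apply/ffunP => i; rewrite !(natvec_addE, ffunE); lia.
Qed.

HB.instance Definition _ :=
  GRing.isZmodMorphism.Build (zvec k) (zvec l) fbar fbar_is_zmod_morphism.

Lemma fbar_vint (n : natvec k) : fbar (vint n) = vint (f n).
Proof.
have -> : vint n = vint n - vint 0 by apply/ffunP => i; rewrite !ffunE subr0.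
by rewrite fbarB raddf0; apply/ffunP => i; rewrite !ffunE subr0.
Qed.

Definition in_ker : {pred zvec k} := fun h => fbar h == 0.

Lemma in_ker_zmod_closed : zmod_closed in_ker.
Proof.
split; first by apply/eqP; rewrite raddf0.
by move=> g h /eqP g0 /eqP h0; apply/eqP; rewrite raddfB /= g0 h0 subrr.
Qed.
HB.instance Definition _ :=
  GRing.isZmodClosed.Build (zvec k) in_ker in_ker_zmod_closed.

Definition kerbar := {h : zvec k | in_ker h}.
HB.instance Definition _ := SubChoice.on kerbar.
HB.instance Definition _ := [SubChoice_isSubZmodule of kerbar by <:].

End GroupCompletion.

(* The convolution product on the free module {malg R[H]}, with
   u_h = << 1 *g h >>; the ring structure of monalg does not apply, as it
   excludes monoids with non-trivial units. *)
Definition galg (R : comNzRingType) (H : zmodType) := {malg R[H]}.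

Section GroupAlgebra.
Variables (R : comNzRingType) (H : zmodType).
HB.instance Definition _ := GRing.Lmodule.on (galg R H).

Implicit Types (x y z : galg R H).

Definition galg_one : galg R H := << 1 *g 0 >>.
Definition galg_mul x y : galg R H :=
  \sum_(g <- msupp x) \sum_(h <- msupp y) << x@_g * y@_h *g g + h >>.

Lemma galg_mulw (d1 d2 : {fset H}) x y :
  (msupp x `<=` d1)%fset -> (msupp y `<=` d2)%fset ->
  galg_mul x y = \sum_(g <- d1) \sum_(h <- d2) << x@_g * y@_h *g g + h >>.
Proof.
move=> le1 le2; rewrite /galg_mul (big_fset_incl _ le1) /=.
  apply/eq_bigr => g _; apply/big_fset_incl => // h _ /mcoeff_outdom ->.
  by rewrite mulr0 monalgU0.
move=> g _ /mcoeff_outdom xg; rewrite big1 // => h _.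
by rewrite xg mul0r monalgU0.
Qed.

Lemma galg_mulC : commutative galg_mul.
Proof.
move=> x y; rewrite /galg_mul exchange_big; apply: eq_bigr => g _.
by apply: eq_bigr => h _; rewrite mulrC addrC.
Qed.

Lemma galg_mulDl : left_distributive galg_mul +%R.
Proof.
move=> x y z; have s := fsubset_refl (msupp z).
rewrite (galg_mulw (msuppD_le x y) s) (galg_mulw (fsubsetUl _ (msupp y)) s).
rewrite (galg_mulw (fsubsetUr (msupp x) _) s) -big_split /=.
apply: eq_bigr => g _; rewrite -big_split /=; apply: eq_bigr => h _.
by rewrite mcoeffD mulrDl monalgUD.
Qed.

Lemma galg_mulUU (a b : R) (g h : H) :
  galg_mul << a *g g >> << b *g h >> = << a * b *g g + h >>.
Proof.
by rewrite (galg_mulw msuppU_le msuppU_le) !big_seq_fset1 !mcoeffUU.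
Qed.

Lemma galg_mul0 x : galg_mul 0 x = 0.
Proof. by rewrite /galg_mul msupp0 big_seq_fset0. Qed.

Let mul_suml I (r : seq I) (F : I -> galg R H) y :
  galg_mul (\sum_(i <- r) F i) y = \sum_(i <- r) galg_mul (F i) y.
Proof.
exact: (big_morph (galg_mul^~ y) (fun _ _ => galg_mulDl _ _ _) (galg_mul0 y)).
Qed.
Let mul_sumr I (r : seq I) (F : I -> galg R H) x :
  galg_mul x (\sum_(i <- r) F i) = \sum_(i <- r) galg_mul x (F i).
Proof.
by rewrite galg_mulC mul_suml; apply: eq_bigr => i _; rewrite galg_mulC.
Qed.

Lemma galg_mulA : associative galg_mul.
Proof.
move=> x y z; rewrite {1}(monalgE x) [LHS]mul_suml.
rewrite [X in galg_mul X y]monalgE [galg_mul _ y]mul_suml [RHS]mul_suml.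
apply: eq_bigr => a _; set u := << _ *g _ >>.
rewrite {1}(monalgE y) [galg_mul (\sum_(b <- _) _) z]mul_suml [LHS]mul_sumr.
rewrite [in RHS](monalgE y) [galg_mul u (\sum_(b <- _) _)]mul_sumr [RHS]mul_suml.
apply: eq_bigr => b _; set v := << _ *g _ >>.
rewrite {1}(monalgE z) [galg_mul v (\sum_(c <- _) _)]mul_sumr [LHS]mul_sumr.
rewrite [in RHS](monalgE z) [RHS]mul_sumr.
by apply: eq_bigr => c _; rewrite !galg_mulUU mulrA addrA.
Qed.

Lemma galg_mul1 : left_id galg_one galg_mul.
Proof.
move=> x; rewrite {1}(monalgE x) mul_sumr [RHS]monalgE.
by apply: eq_bigr => g _; rewrite galg_mulUU mul1r add0r.
Qed.

Lemma galg_oner_neq0 : galg_one != 0.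
Proof. by rewrite monalgU_eq0 oner_eq0. Qed.

HB.instance Definition _ := GRing.Zmodule_isComNzRing.Build (galg R H)
  galg_mulA galg_mulC galg_mul1 galg_mulDl galg_oner_neq0.

End GroupAlgebra.

Section Iota.
Variables (K : fieldType) (k l : nat) (f : {additive natvec k -> natvec l}).
Variables (V : finType) (G : kgraph l V).
Local Notation A := (KP K (pullback f G)).

(* s_{(m, n)} and s_{(m, n)^*}; they are only used when deg m = f n,
   which in Uker holds because f (vpos h) = f (vneg h) for h in the kernel. *)
Definition pb_s (m : G) (n : natvec k) : A :=
  if insub (m, n) is Some x then kp_s (x : pullback f G) else 0.
Definition pb_ss (m : G) (n : natvec k) : A :=
  if insub (m, n) is Some x then kp_ss (x : pullback f G) else 0.

Definition Uker (h : kerbar f) : A :=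
  \sum_(v : V) \sum_(m \in paths G v (f (vpos (val h))))
    pb_s m (vpos (val h)) * pb_ss m (vneg (val h)).

Definition iota_gal (c : galg K (kerbar f)) : A :=
  \sum_(h <- msupp c) c@_h *: Uker h.

End Iota.

Arguments iota_gal {K k l f V} G c.

HB.mixin Record isTwoSided (R : pzRingType) (S : R -> bool) := {
  ideal_mull_subproof : forall a x, x \in S -> a * x \in S;
  ideal_mulr_subproof : forall a x, x \in S -> x * a \in S
}.

#[short(type="ideal")]
HB.structure Definition TwoSidedIdeal (R : pzRingType) :=
  {S of GRing.ZmodClosed R S & isTwoSided R S}.

Section IdealTheory.
Variable R : pzRingType.
Implicit Types (I J : ideal R).

Lemma ideal_mull I a x : x \in I -> a * x \in I.
Proof. exact: ideal_mull_subproof. Qed.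
Lemma ideal_mulr I a x : x \in I -> x * a \in I.
Proof. exact: ideal_mulr_subproof. Qed.

Lemma ideal_eqP I J : I =i J -> I = J.
Proof.
case: I J => S c [S' c'] e.
have {}e : S = S' by apply/funext => x; exact: e.
subst S'; congr TwoSidedIdeal.Pack.
move: c c' => [[a1] [a2] [a3 a4]] [[b1] [b2] [b3 b4]].
by rewrite (Prop_irrelevance a1 b1) (Prop_irrelevance a2 b2)
  (Prop_irrelevance a3 b3) (Prop_irrelevance a4 b4).
Qed.

End IdealTheory.

Section IdealLattice.
Variable R : pzRingType.

Section MeetJoin.
Variables I J : ideal R.

Definition ideal_meet : R -> bool := fun x => (x \in I) && (x \in J).
Definition ideal_join : R -> bool :=
  fun x => `[< exists y z, [/\ y \in I, z \in J & x = y + z] >].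

Lemma ideal_meet_zmod : zmod_closed ideal_meet.
Proof.
split; first by apply/andP; rewrite !rpred0.
by move=> x y /andP[? ?] /andP[? ?]; apply/andP; rewrite !rpredB.
Qed.
Lemma ideal_meet_mull a x : x \in ideal_meet -> a * x \in ideal_meet.
Proof. by move=> /andP[? ?]; apply/andP; rewrite !ideal_mull. Qed.
Lemma ideal_meet_mulr a x : x \in ideal_meet -> x * a \in ideal_meet.
Proof. by move=> /andP[? ?]; apply/andP; rewrite !ideal_mulr. Qed.
HB.instance Definition _ := GRing.isZmodClosed.Build R ideal_meet ideal_meet_zmod.
HB.instance Definition _ :=
  isTwoSided.Build R ideal_meet ideal_meet_mull ideal_meet_mulr.

Lemma ideal_join_zmod : zmod_closed ideal_join.
Proof.
split; first by apply/asboolP; exists 0, 0; rewrite !rpred0 addr0.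
move=> x y /asboolP[a [b [aI bJ ->]]] /asboolP[c [d [cI dJ ->]]].
by apply/asboolP; exists (a - c), (b - d); rewrite !rpredB // opprD addrACA.
Qed.
Lemma ideal_join_mull a x : x \in ideal_join -> a * x \in ideal_join.
Proof.
move=> /asboolP[y [z [yI zJ ->]]]; apply/asboolP; exists (a * y), (a * z).
by rewrite !ideal_mull // mulrDr.
Qed.
Lemma ideal_join_mulr a x : x \in ideal_join -> x * a \in ideal_join.
Proof.
move=> /asboolP[y [z [yI zJ ->]]]; apply/asboolP; exists (y * a), (z * a).
by rewrite !ideal_mulr // mulrDl.
Qed.
HB.instance Definition _ := GRing.isZmodClosed.Build R ideal_join ideal_join_zmod.
HB.instance Definition _ :=
  isTwoSided.Build R ideal_join ideal_join_mull ideal_join_mulr.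

End MeetJoin.

HB.instance Definition _ := gen_eqMixin (ideal R).
HB.instance Definition _ := gen_choiceMixin (ideal R).

Definition ideal_le (I J : ideal R) : bool := `[< {subset I <= J} >].

Lemma ideal_le_refl : reflexive ideal_le.
Proof. by move=> I; apply/asboolP. Qed.
Lemma ideal_le_anti : antisymmetric ideal_le.
Proof.
move=> I J /andP[/asboolP IJ /asboolP JI]; apply: ideal_eqP => x.
by apply/idP/idP => [/IJ|/JI].
Qed.
Lemma ideal_le_trans : transitive ideal_le.
Proof.
by move=> J I M /asboolP IJ /asboolP JM; apply/asboolP => x /IJ /JM.
Qed.

Fact ideal_display : Order.disp_t. Proof. exact: Order.Disp tt tt. Qed.

HB.instance Definition _ := Order.Le_isPOrder.Build ideal_display (ideal R)
  ideal_le_refl ideal_le_anti ideal_le_trans.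

Definition idealI (I J : ideal R) : ideal R :=
  TwoSidedIdeal.clone R (ideal_meet I J) _.
Definition idealD (I J : ideal R) : ideal R :=
  TwoSidedIdeal.clone R (ideal_join I J) _.

Lemma ideal_meetP (M I J : ideal R) :
  ((M <= idealI I J) = (M <= I) && (M <= J))%O.
Proof.
apply/asboolP/andP => [h|[/asboolP MI /asboolP MJ] x xM].
  by split; apply/asboolP => x /h /andP[].
by apply/andP; rewrite MI // MJ.
Qed.

Lemma ideal_joinP (I J M : ideal R) :
  ((idealD I J <= M) = (I <= M) && (J <= M))%O.
Proof.
apply/asboolP/andP => [h|[/asboolP IM /asboolP JM] x].
  split; apply/asboolP => x xI; apply: h; apply/asboolP.
    by exists x, 0; rewrite rpred0 addr0.
  by exists 0, x; rewrite rpred0 add0r.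
by move=> /asboolP[y [z [/IM yM /JM zM ->]]]; exact: rpredD.
Qed.

HB.instance Definition _ := Order.POrder_MeetJoin_isLattice.Build
  ideal_display (ideal R) ideal_meetP ideal_joinP.

End IdealLattice.

(* The quotient R / I, as a ring: ring_quotient only covers proper ideals of
   commutative rings. *)
Definition quo (R : pzRingType) (I : ideal R) := Quotient.quot I.

Section QuotientRing.
Variables (R : pzRingType) (I : ideal R).
Local Notation Q := (quo I).

HB.instance Definition _ := GRing.Zmodule.on Q.
HB.instance Definition _ : EqQuotient R (Quotient.equiv I) Q :=
  EqQuotient.on Q.

Definition to_quo (x : R) : Q := \pi_Q x.

Lemma to_quoP x y : reflect (to_quo x = to_quo y) (x - y \in I).
Proof. by rewrite Quotient.idealrBE; exact: eqP. Qed.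

Definition quo_one : Q := to_quo 1.
Definition quo_mul := lift_op2 Q (@GRing.mul R).

Lemma quo_mulE x y : quo_mul (to_quo x) (to_quo y) = to_quo (x * y).
Proof.
have h z : repr (to_quo z) - z \in I by apply/to_quoP; rewrite /to_quo reprK.
unlock quo_mul; apply/to_quoP.
set a := repr _; set b := repr _.
have -> : a * b - x * y = a * (b - y) + (a - x) * y.
  by rewrite mulrBr mulrBl addrA subrK.
by apply: rpredD; [apply: ideal_mull | apply: ideal_mulr]; exact: h.
Qed.

Lemma to_quo_zmod_morphism : zmod_morphism to_quo.
Proof. by move=> x y; rewrite /to_quo !piE. Qed.
HB.instance Definition _ :=
  GRing.isZmodMorphism.Build R Q to_quo to_quo_zmod_morphism.

Lemma quoW (P : Q -> Prop) : (forall x, P (to_quo x)) -> forall q, P q.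
Proof. by move=> h; elim/quotW. Qed.

Lemma quo_mulA : associative quo_mul.
Proof.
by elim/quoW=> x; elim/quoW=> y; elim/quoW=> z; rewrite !quo_mulE mulrA.
Qed.
Lemma quo_mul1 : left_id quo_one quo_mul.
Proof. by elim/quoW=> x; rewrite quo_mulE mul1r. Qed.
Lemma quo_mulr1 : right_id quo_one quo_mul.
Proof. by elim/quoW=> x; rewrite quo_mulE mulr1. Qed.
Lemma quo_mulDl : left_distributive quo_mul +%R.
Proof.
elim/quoW=> x; elim/quoW=> y; elim/quoW=> z.
by rewrite -raddfD /= !quo_mulE -raddfD mulrDl.
Qed.
Lemma quo_mulDr : right_distributive quo_mul +%R.
Proof.
elim/quoW=> x; elim/quoW=> y; elim/quoW=> z.
by rewrite -raddfD /= !quo_mulE -raddfD mulrDr.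
Qed.
HB.instance Definition _ := GRing.Zmodule_isPzRing.Build Q
  quo_mulA quo_mul1 quo_mulr1 quo_mulDl quo_mulDr.

Lemma to_quo_monoid_morphism : monoid_morphism to_quo.
Proof. by split=> // x y; rewrite -quo_mulE. Qed.
HB.instance Definition _ :=
  GRing.isMonoidMorphism.Build R Q to_quo to_quo_monoid_morphism.

End QuotientRing.

Arguments to_quo {R} I x.

Section ComQuotientRing.
Variables (R : comPzRingType) (I : ideal R).

Lemma quo_mulC : commutative (@GRing.mul (quo I)).
Proof. by elim/quoW=> x; elim/quoW=> y; rewrite -!rmorphM mulrC. Qed.
HB.instance Definition _ :=
  GRing.PzRing_hasCommutativeMul.Build (quo I) quo_mulC.

End ComQuotientRing.

(* A S and S A, for a subset S of A: the sets of finite sums of products. *)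
Section IdealProducts.
Variables (A : pzRingType) (S : set A).

Definition set_mull : set A :=
  [set x | exists2 s : seq (A * A), (forall p, p \in s -> S p.2) &
                                    x = \sum_(p <- s) p.1 * p.2].
Definition set_mulr : set A :=
  [set x | exists2 s : seq (A * A), (forall p, p \in s -> S p.1) &
                                    x = \sum_(p <- s) p.1 * p.2].

End IdealProducts.

(* Main.v *)
Require Import Defs.
From HB Require Import structures.
From mathcomp Require Import all_boot all_order all_algebra.
From mathcomp Require Import boolp classical_sets cardinality fsbigop.
From mathcomp Require Import finmap monalg.

(** Write G for the l-graph, A for KP_K of its pullback, H for the kernel,
    C = K[H], and let J be an ideal of C.

    Why the quotient of A by A iota(J) is KP_(C/J)(G). A morphism of the
    pullback is a pair (a, n) with deg a = f n, so for a given path a of G the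
    possible n differ by elements of H. In A, the central unit U_h with
    h = m - n carries s_(a, n) to s_(a, m) (twist_s). Choose an additive
    section g of f. Then every s_(a, n) is U_(n - g (f n)) s_(a, g (f n)), so
    that A is generated over iota(C) by the s_(a, g (deg a)), and these satisfy
    the Kumjian-Pask relations of G. In one direction, theta sends s_(a, n) to
    u_(n - g (f n)) s_a and kills iota(J); in the other direction, psi sends
    s_a to the class of s_(a, g (deg a)) and lets C/J act through iota. They
    are mutually inverse on generators (psi_theta, psiK). The facts about U_h
    that this uses, additivity in h and centrality, come from the freedom to
    write h as any difference m - n (twist_add, twistM, twist_central).

    Why the ideals of A are those of C. Two facts on KP_R(G), for an arbitrary
    commutative ring R, are applied to R = C/J. First, r p_v is not zero when r
    is not zero (kp_pZ_eq0). Hence iota c lies in A iota(J) exactly if its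
    image r 1 vanishes in KP_(C/J)(G), where r is the class of c, that is,
    exactly if c lies in J (ideal_ofK). Second, for G aperiodic and cofinal,
    a non-zero ideal of KP_R(G) contains r 1 for some non-zero r
    (kp_uniqueness and kp_cofinal). For an ideal I of A this is used with
    J = iota^-1(I): the image of I in KP_(C/J)(G) cannot contain such an
    element, so it is zero and I = A iota(J) (coef_idealK). *)

Set Implicit Arguments.
Unset Strict Implicit.
Unset Printing Implicit Defensive.

Import Order.TTheory GRing.Theory.

Local Open Scope ring_scope.

(** * Factorisations and infinite paths in a k-graph *)

Section NatVectors.
Variable k : nat.
Implicit Types p q n : natvec k.

Lemma vleP p q : reflect (exists c, q = p + c) (vle p q).
Proof.
apply: (iffP forallP) => [pq|[c ->] i]; last by rewrite natvec_addE leq_addr.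
exists [ffun i => (q i - p i)%N]; apply/ffunP => i.
by rewrite natvec_addE ffunE subnKC.
Qed.

Lemma vle_addr p q : vle p (p + q).
Proof. by apply/vleP; exists q. Qed.

Lemma vle_addl p q : vle q (p + q).
Proof. by rewrite addrC vle_addr. Qed.

Lemma natvec_addI p : injective (+%R p).
Proof.
move=> q n /ffunP e; apply/ffunP => i; move: (e i).
by rewrite !natvec_addE => /addnI.
Qed.

Lemma vle_cancel p q n : vle (p + q) (p + n) -> vle q n.
Proof.
by case/vleP=> c; rewrite -addrA => /natvec_addI ->; apply: vle_addr.
Qed.

Lemma natvec_subE p c : [ffun i => ((p + c)%R i - p i)%N] = c.
Proof. by apply/ffunP => i; rewrite ffunE natvec_addE addKn. Qed.

Definition vconst (j : nat) : natvec k := [ffun=> j].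

Lemma vconst0 : vconst 0 = 0. Proof. by apply/ffunP => i; rewrite !ffunE. Qed.

Lemma vconstS j : vconst j.+1 = vconst j + vconst 1.
Proof. by apply/ffunP => i; rewrite natvec_addE !ffunE addn1. Qed.

End NatVectors.

Section Factorisations.
Variables (k : nat) (V : countType) (L : kgraph k V).
Implicit Types a b c : L.

(** The uniqueness half of the factorisation property: a factorisation is
    determined by the degree of its first factor. *)
Lemma kcomp_inj a b a' b' : src a = rng b -> src a' = rng b' ->
  deg a = deg a' -> kcomp a b = kcomp a' b' -> a = a' /\ b = b'.
Proof.
move=> ab ab' da e.
have db : deg b = deg b'.
  apply: (@natvec_addI _ (deg a)); rewrite {2}da.
  by rewrite -!deg_comp // e.
have := @factorisation _ _ L (kcomp a b) (deg a) (deg b) (deg_comp ab).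
case=> p [_ up].
have e1 : p = (a, b) by apply: up.
have e2 : p = (a', b') by apply: up; split => //=.
by move: e2; rewrite e1 => -[].
Qed.

Lemma kcomp_split a m n : deg a = m + n ->
  exists b c, [/\ src b = rng c, kcomp b c = a, deg b = m & deg c = n].
Proof. by move=> /factorisation[[b c] [h _]]; exists b, c. Qed.

Lemma kcomp_splitle a m : vle m (deg a) ->
  exists b c, [/\ src b = rng c, kcomp b c = a & deg b = m].
Proof.
move=> /vleP[n /kcomp_split[b [c [? ? ? _]]]]; by exists b, c.
Qed.

Lemma mem_paths (Lfin : row_finite L) v n a :
  (a \in fset_set (paths L v n)) = (rng a == v) && (deg a == n).
Proof.
rewrite in_fset_set; last exact: Lfin.
apply/idP/andP => [/set_mem[-> ->]//|[/eqP ? /eqP ?]].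
exact: mem_set.
Qed.

End Factorisations.

Section InfinitePathTheory.
Variables (k : nat) (V : countType) (L : kgraph k V).

(** The vertices are recovered from the morphisms, as ranges of the
    identities. *)
Lemma infpath_ext (x y : infpath L) :
  (forall p q (pq : vle p q), imor x pq = imor y pq) -> x = y.
Proof.
move=> e.
have ev p : ivtx x p = ivtx y p.
  by rewrite -(rng_imor x (vle_refl p)) -(rng_imor y (vle_refl p)) e.
case: x y e ev => [v m h1 h2 h3 h4 h5] [v' m' h1' h2' h3' h4' h5'] /= e ev.
have {}ev : v = v' by apply/funext.
have {}e : m = m'.
  apply: functional_extensionality_dep => p.
  apply: functional_extensionality_dep => q.
  by apply: functional_extensionality_dep => pq.
subst v' m'.
by congr InfPath; apply: Prop_irrelevance.
Qed.

(** An infinite path amounts to a coherent choice of initial segments X p: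
    the morphism from p to q is what extends X p to X q, and left
    cancellation makes this assignment functorial. *)
Lemma infpath_of_prefixes (X : natvec k -> L) :
  (forall p, deg (X p) = p) ->
  (forall p q, vle p q -> exists b, src (X p) = rng b /\ X q = kcomp (X p) b) ->
  exists x : infpath L, forall p, ivtx x p = src (X p).
Proof.
move=> dX hX.
pose m p q (pq : vle p q) : L := projT1 (cid (hX p q pq)).
have mP p q (pq : vle p q) : src (X p) = rng (m p q pq) /\
    X q = kcomp (X p) (m p q pq).
  by rewrite /m; case: cid.
have m_uniq p q (pq : vle p q) b : src (X p) = rng b -> X q = kcomp (X p) b ->
    m p q pq = b.
  move=> e1 e2; have [e3 e4] := mP p q pq.
  have [] // := kcomp_inj e3 e1 erefl _.
  by rewrite -e2.
have h1 p q (pq : vle p q) : rng (m p q pq) = src (X p).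
  by have [] := mP p q pq.
have h2 p q (pq : vle p q) : src (m p q pq) = src (X q).
  by have [e ->] := mP p q pq; rewrite src_comp.
have h3 p : m p p (vle_refl p) = idm (src (X p)).
  by apply: m_uniq; rewrite ?rng_idm ?comp_idr.
have h4 p q t (pq : vle p q) (qt : vle q t) :
    m p t (vle_trans pq qt) = kcomp (m p q pq) (m q t qt).
  have [e1 e2] := mP p q pq; have [e3 e4] := mP q t qt.
  have e5 : src (m p q pq) = rng (m q t qt) by rewrite h2.
  by apply: m_uniq; rewrite ?rng_comp // comp_assoc // -e2 -e4.
have h5 p q (pq : vle p q) : deg (m p q pq) = [ffun i => (q i - p i)%N].
  have [e1 e2] := mP p q pq.
  by rewrite -[in RHS](dX q) e2 deg_comp // dX natvec_subE.
by exists (InfPath h1 h2 h3 h4 h5).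
Qed.

(** Following the steps nxt produces a path y j of degree (j, ..., j) for
    every j, and these extend each other; their initial segments give the
    infinite path. Each of its vertices lies on some y j, whose source is
    good: a good vertex can be reached from everywhere on the infinite path,
    which is all that cofinality needs. *)
Lemma infpath_of_steps (nxt : V -> L) (good : V -> Prop) (w : V) :
  good w ->
  (forall v, good v ->
    [/\ rng (nxt v) = v, deg (nxt v) = vconst k 1 & good (src (nxt v))]) ->
  exists x : infpath L,
    forall p, exists b : L, rng b = ivtx x p /\ good (src b).
Proof.
move=> gw hn.
pose y j : L := iteri j (fun _ l => kcomp l (nxt (src l))) (idm w).
have yP j : deg (y j) = vconst k j /\ good (src (y j)).
  elim: j => [|j [dj gj]]; first by rewrite /= deg_idm src_idm vconst0.
  have [r d g] := hn _ gj.
  by rewrite /= deg_comp ?r // src_comp ?r // dj d -vconstS.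
have y_ext i j : exists z, src (y i) = rng z /\ y (j + i)%N = kcomp (y i) z.
  elim: j => [|j [z [e1 e2]]].
    by exists (idm (src (y i))); rewrite rng_idm comp_idr.
  have [_ gj] := yP (j + i)%N; have [r d g] := hn _ gj.
  have sz : src z = rng (nxt (src (y (j + i)%N))) by rewrite r e2 src_comp.
  exists (kcomp z (nxt (src (y (j + i)%N)))).
  by rewrite rng_comp // comp_assoc // -e2.
(* Any bound on the coordinates of p would do; the sum is monotone. *)
pose sz (p : natvec k) := (\sum_i p i)%N.
have szP p : vle p (vconst k (sz p)).
  by apply/forallP => i; rewrite ffunE /sz (bigD1 i) //= leq_addr.
have cut p : exists b c, [/\ src b = rng c, kcomp b c = y (sz p) & deg b = p].
  by apply: kcomp_splitle; rewrite (yP _).1.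
pose X p : L := projT1 (cid (cut p)).
have XP p : exists c, [/\ src (X p) = rng c, kcomp (X p) c = y (sz p)
    & deg (X p) = p].
  by rewrite /X; case: cid.
have dX p : deg (X p) = p by case: (XP p) => c [].
have [x xP] : exists x : infpath L, forall p, ivtx x p = src (X p).
  apply: infpath_of_prefixes => // p q pq.
  have [c [e1 e2 _]] := XP p; have [c' [e1' e2' _]] := XP q.
  have pq' : (sz p <= sz q)%N.
    by apply: leq_sum => i _; apply: (forallP pq).
  have [z [f1 f2]] := y_ext (sz p) (sz q - sz p)%N.
  rewrite subnK // in f2.
  have [a [d [g1 g2 g3]]] : exists a d, [/\ src a = rng d, kcomp a d = X q
      & deg a = p] by apply: kcomp_splitle; rewrite dX.
  have sd : src d = rng c' by rewrite -e1' -g2 src_comp.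
  have scz : src c = rng z by rewrite -f1 -e2 src_comp.
  have e : kcomp a (kcomp d c') = kcomp (X p) (kcomp c z).
    by rewrite !comp_assoc // g2 e2 e2' -f2.
  have [] := kcomp_inj _ _ _ e; rewrite ?rng_comp ?dX // => ea _.
  by exists d; rewrite -g2 -ea.
exists x => p; have [c [e1 e2 _]] := XP p.
exists c; rewrite xP; split=> //.
by have [_] := yP (sz p); rewrite -e2 src_comp.
Qed.

End InfinitePathTheory.

(** * The universal property and the relations of Kumjian-Pask algebras *)

(** A Kumjian-Pask family in a ring. Vertices are degree 0 paths, so the
    relations p_r s = s = s p_s and their ghost versions are the instances of
    fam_M and fam_gM in which one factor is an identity. *)
Record kp_family k (V : countType) (L : kgraph k V) (B : pzRingType)
    (P : V -> B) (S SS : L -> B) : Prop := KPFamily {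
  fam_idm : forall v, S (idm v) = P v;
  fam_gidm : forall v, SS (idm v) = P v;
  fam_pp : forall v w, P v * P w = if v == w then P v else 0;
  fam_M : forall a b, src a = rng b -> S a * S b = S (kcomp a b);
  fam_gM : forall a b, src a = rng b -> SS b * SS a = SS (kcomp a b);
  fam_gs : forall a b, deg a = deg b ->
    SS a * S b = if a == b then P (src a) else 0;
  fam_sum : forall v n, n <> 0 ->
    P v = \sum_(a <- fset_set (paths L v n)) S a * SS a
}.

Section Universal.
Local Open Scope quotient_scope.
Variables (R : comPzRingType) (k : nat) (V : countType) (L : kgraph k V).
Variables (B : pzRingType) (sc : {rmorphism R -> B}).
Variables (P : V -> B) (S SS : L -> B).
Hypothesis sc_central : forall r x, sc r * x = x * sc r.
Hypothesis fam : kp_family P S SS.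

Fixpoint kp_eval (t : kpterm R L) : B :=
  match t with
  | Tp v => P v
  | Ts l => S l
  | Tss l => SS l
  | Tzero => 0
  | Tadd x y => kp_eval x + kp_eval y
  | Topp x => - kp_eval x
  | Tscale r x => sc r * kp_eval x
  | Tmul x y => kp_eval x * kp_eval y
  end.

Lemma kp_evalP x y : kpeq x y -> kp_eval x = kp_eval y.
Proof.
elim=> {x y} //=.
- by move=> x y z _ -> _ ->.
- by move=> x x' y y' _ -> _ ->.
- by move=> x x' _ ->.
- by move=> r x x' _ ->.
- by move=> x x' y y' _ -> _ ->.
- by move=> x y z; rewrite addrA.
- by move=> x y; rewrite addrC.
- by move=> x; rewrite add0r.
- by move=> x; rewrite addNr.
- by move=> r t x; rewrite rmorphM mulrA.
- by move=> x; rewrite rmorph1 mul1r.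
- by move=> r x y; rewrite mulrDr.
- by move=> r t x; rewrite rmorphD mulrDl.
- by move=> x y z; rewrite mulrA.
- by move=> x y z; rewrite mulrDl.
- by move=> x y z; rewrite mulrDr.
- by move=> r x y; rewrite mulrA.
- by move=> r x y; rewrite !mulrA sc_central.
- exact: fam_idm fam.
- exact: fam_gidm fam.
- by move=> v; rewrite (fam_pp fam) eqxx.
- by move=> v w /eqP/negbTE vw; rewrite (fam_pp fam) vw.
- exact: fam_M fam.
- exact: fam_gM fam.
- by move=> a; rewrite -(fam_idm fam) (fam_M fam) ?src_idm ?comp_idl.
- by move=> a; rewrite -(fam_idm fam) (fam_M fam) ?rng_idm ?comp_idr.
- by move=> a; rewrite -(fam_gidm fam) (fam_gM fam) ?rng_idm ?comp_idr.
- by move=> a; rewrite -(fam_gidm fam) (fam_gM fam) ?src_idm ?comp_idl.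
- by move=> a; rewrite (fam_gs fam) ?eqxx.
- by move=> a b /(fam_gs fam) -> /eqP/negbTE ->.
- move=> v n n0; rewrite (fam_sum fam v n0).
  by rewrite (big_morph kp_eval (id1 := 0) (op1 := +%R)).
Qed.

Definition kp_lift_fun (x : KP R L) : B := kp_eval (repr x).

Lemma kp_lift_pi t : kp_lift_fun (\pi t) = kp_eval t.
Proof. exact/kp_evalP/kp_repr_pi. Qed.

End Universal.

Section UniversalMorphism.
Local Open Scope quotient_scope.
Variables (R : comPzRingType) (k : nat) (V : finType) (L : kgraph k V).
Variables (B : pzRingType) (sc : {rmorphism R -> B}).
Variables (P : V -> B) (S SS : L -> B).
Hypothesis sc_central : forall r x, sc r * x = x * sc r.
Hypothesis fam : kp_family P S SS.
Hypothesis fam1 : \sum_v P v = 1.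

Let lift := kp_lift_fun sc P S SS.
Let lift_pi := kp_lift_pi sc_central fam.

Lemma kp_lift_zmod : zmod_morphism lift.
Proof.
elim/quotW=> x; elim/quotW=> y.
rewrite [X in lift X](_ : _ = \pi_(KP R L) (Tadd x (Topp y))).
  by rewrite /lift !lift_pi.
by rewrite -kp_addE -kp_oppE.
Qed.

Lemma kp_lift_monoid : monoid_morphism lift.
Proof.
split=> [|x y].
  pose lift' : {additive KP R L -> B} :=
    HB.pack lift (GRing.isZmodMorphism.Build _ _ lift kp_lift_zmod).
  rewrite -fam1 -[lift]/(lift' : _ -> _) -[1]/(\sum_v kp_p L v) raddf_sum.
  by apply: eq_bigr => v _; apply: lift_pi.
elim/quotW: x => x; elim/quotW: y => y.
rewrite [X in lift X](_ : _ = \pi_(KP R L) (Tmul x y)).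
  by rewrite /lift !lift_pi.
by rewrite -kp_mulE.
Qed.

(** The universal property. The scalars act on the target through a central
    ring morphism from R, so that the target may be an algebra over a
    different ring. *)
Definition kp_lift : {rmorphism KP R L -> B} :=
  HB.pack lift (GRing.isZmodMorphism.Build _ _ lift kp_lift_zmod)
    (GRing.isMonoidMorphism.Build _ _ lift kp_lift_monoid).

Lemma kp_lift_p v : kp_lift (kp_p L v) = P v. Proof. exact: lift_pi. Qed.
Lemma kp_lift_s l : kp_lift (kp_s l) = S l. Proof. exact: lift_pi. Qed.
Lemma kp_lift_ss l : kp_lift (kp_ss l) = SS l. Proof. exact: lift_pi. Qed.

Lemma kp_lift_scale r x : kp_lift (r *: x) = sc r * kp_lift x.
Proof.
elim/quotW: x => x.
rewrite [X in kp_lift X](_ : _ = \pi_(KP R L) (Tscale r x)).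
  by rewrite /= /lift !lift_pi.
by rewrite -kp_scaleE.
Qed.

End UniversalMorphism.

Section KPRing.
Local Open Scope quotient_scope.
Variables (R : comPzRingType) (k : nat) (V : finType) (L : kgraph k V).
Local Notation A := (KP R L).
Implicit Types (a b : L) (x y : A).

Lemma kp_ind (Q : A -> Prop) :
  (forall v, Q (kp_p L v)) -> (forall a, Q (kp_s a)) ->
  (forall a, Q (kp_ss a)) -> Q 0 ->
  (forall x y, Q x -> Q y -> Q (x + y)) -> (forall x, Q x -> Q (- x)) ->
  (forall r x, Q x -> Q (r *: x)) ->
  (forall x y, Q x -> Q y -> Q (x * y)) -> forall x, Q x.
Proof.
move=> Qp Qs Qss Q0 QD QN QZ QM.
elim/quotW; elim=> [v|l|l||x IHx y IHy|x IHx|r x IHx|x IHx y IHy].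
- exact: Qp.
- exact: Qs.
- exact: Qss.
- exact: Q0.
- by rewrite -kp_addE; apply: QD.
- by rewrite -kp_oppE; apply: QN.
- by rewrite -kp_scaleE; apply: QZ.
- by rewrite -kp_mulE; apply: QM.
Qed.

Lemma kp_mulZl r x y : (r *: x) * y = r *: (x * y).
Proof. by rewrite /GRing.mul /= kp_scaleAl. Qed.

Lemma kp_mulZr r x y : x * (r *: y) = r *: (x * y).
Proof. by rewrite /GRing.mul /= kp_scaleAr. Qed.

Lemma kp_mulZZ r t x y : (r *: x) * (t *: y) = (r * t) *: (x * y).
Proof. by rewrite kp_mulZl kp_mulZr scalerA. Qed.

(** The central structure morphism of KP as an R-algebra. *)
Definition kp_scalar (r : R) : A := r *: (1 : A).

Lemma kp_scalar_zmod : zmod_morphism kp_scalar.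
Proof. by move=> r t; rewrite /kp_scalar scalerBl. Qed.
HB.instance Definition _ :=
  GRing.isZmodMorphism.Build R A kp_scalar kp_scalar_zmod.
Lemma kp_scalar_monoid : monoid_morphism kp_scalar.
Proof.
split=> [|r t]; first by rewrite /kp_scalar scale1r.
by rewrite /kp_scalar kp_mulZl mul1r scalerA.
Qed.
HB.instance Definition _ :=
  GRing.isMonoidMorphism.Build R A kp_scalar kp_scalar_monoid.

Lemma kp_scalarM r x : kp_scalar r * x = r *: x.
Proof. by rewrite kp_mulZl mul1r. Qed.

Lemma kp_scalar_central r x : kp_scalar r * x = x * kp_scalar r.
Proof. by rewrite kp_scalarM kp_mulZr mulr1. Qed.

Lemma kp_1E : 1 = \sum_v kp_p L v :> A. Proof. by []. Qed.

Lemma kp_idm v : kp_s (idm v) = kp_p L v :> A.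
Proof. exact/kp_piP/kp_s_idm. Qed.

Lemma kp_gidm v : kp_ss (idm v) = kp_p L v :> A.
Proof. exact/kp_piP/kp_ss_idm. Qed.

Lemma kp_pp v w : kp_p L v * kp_p L w = (if v == w then kp_p L v else 0) :> A.
Proof.
rewrite /GRing.mul /= kp_mulE.
by case: eqP => [->|vw]; apply/kp_piP; [apply: kp1_idem | apply: kp1_orth].
Qed.

Lemma kp_rs a : kp_p L (rng a) * kp_s a = kp_s a :> A.
Proof. by rewrite /GRing.mul /= kp_mulE; exact/kp_piP/kp2_ps. Qed.
Lemma kp_sr a : kp_s a * kp_p L (src a) = kp_s a :> A.
Proof. by rewrite /GRing.mul /= kp_mulE; exact/kp_piP/kp2_sp. Qed.
Lemma kp_rss a : kp_p L (src a) * kp_ss a = kp_ss a :> A.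
Proof. by rewrite /GRing.mul /= kp_mulE; exact/kp_piP/kp2_pss. Qed.
Lemma kp_ssr a : kp_ss a * kp_p L (rng a) = kp_ss a :> A.
Proof. by rewrite /GRing.mul /= kp_mulE; exact/kp_piP/kp2_ssp. Qed.

Lemma kp_sM a b :
  kp_s a * kp_s b = (if src a == rng b then kp_s (kcomp a b) else 0) :> A.
Proof.
case: eqP => [e|/eqP/negbTE ne].
  by rewrite /GRing.mul /= kp_mulE; exact/kp_piP/kp2_s.
by rewrite -kp_sr -(kp_rs b) mulrA -(mulrA (kp_s a)) kp_pp ne mulr0 mul0r.
Qed.

Lemma kp_ssM a b :
  kp_ss b * kp_ss a = (if src a == rng b then kp_ss (kcomp a b) else 0) :> A.
Proof.
case: eqP => [e|/eqP/negbTE ne].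
  by rewrite /GRing.mul /= kp_mulE; exact/kp_piP/kp2_ss.
by rewrite -kp_ssr -(kp_rss a) mulrA -(mulrA (kp_ss b)) kp_pp eq_sym ne mulr0 mul0r.
Qed.

Lemma kp_sss a b : deg a = deg b ->
  kp_ss a * kp_s b = (if a == b then kp_p L (src a) else 0) :> A.
Proof.
move=> dab; rewrite /GRing.mul /= kp_mulE.
by case: eqP => [->|ab]; apply/kp_piP; [apply: kp3_eq | apply: kp3_neq].
Qed.

Lemma kp_family_gen :
  kp_family (fun v => kp_p L v : A) (fun a => kp_s a : A)
    (fun a => kp_ss a : A).
Proof.
split.
- exact: kp_idm.
- exact: kp_gidm.
- exact: kp_pp.
- by move=> a b e; rewrite kp_sM e eqxx.
- by move=> a b e; rewrite kp_ssM e eqxx.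
- exact: kp_sss.
- move=> v n n0.
  have -> : \sum_(a <- fset_set (paths L v n)) kp_s a * kp_ss a =
    \pi_A (\big[@Tadd R k V L/Tzero]_(l <- fset_set (paths L v n))
       Tmul (Ts l) (Tss l)).
    rewrite (big_morph (fun t => \pi_A t) (id1 := 0) (op1 := +%R)) //.
      by apply: eq_bigr => l _; rewrite /GRing.mul /= kp_mulE.
    by move=> s t; rewrite -kp_addE.
  exact/kp_piP/kp4.
Qed.

(** Summing over all ranges at once turns (KP4) into a decomposition of the
    unit. *)
Definition degpaths n : {fset L} := fset_set [set a : L | deg a = n]%classic.

Hypothesis Lfin : row_finite L.

Lemma mem_degpaths n a : (a \in degpaths n) = (deg a == n).
Proof.
rewrite in_fset_set.
  by apply/idP/eqP => [/set_mem|?]; last exact: mem_set.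
apply: (@sub_finite_set _ _ (\bigcup_(v in [set: V]) paths L v n)).
  by move=> l /= dl; exists (rng l).
by apply: bigcup_finite => [|v _]; [exact: finite_finset | exact: Lfin].
Qed.

Lemma sum_degpaths (M : nmodType) (F : L -> M) n :
  \sum_(a <- degpaths n) F a =
  \sum_v \sum_(a <- fset_set (paths L v n)) F a.
Proof.
rewrite (partition_big (fun a => rng a) xpredT) //=; apply: eq_bigr => v _.
rewrite -big_filter; apply: perm_big; apply: uniq_perm.
- exact/filter_uniq/fset_uniq.
- exact: fset_uniq.
by move=> a; rewrite mem_filter mem_degpaths mem_paths.
Qed.

(** For n = 0 the only path is the identity of v, so (KP4) extends to all
    degrees. *)
Lemma kp_sum v n :
  kp_p L v = \sum_(a <- fset_set (paths L v n)) kp_s a * kp_ss a :> A.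
Proof.
have [->|/eqP n0] := eqVneq n 0; last exact: (fam_sum kp_family_gen).
rewrite (perm_big [:: idm v]) ?big_seq1 ?kp_idm ?kp_gidm ?kp_pp ?eqxx //.
apply: uniq_perm => [||a]; rewrite ?fset_uniq // mem_paths // inE.
apply/andP/eqP => [[/eqP <- /eqP /deg0_idm]//|->].
by rewrite rng_idm deg_idm.
Qed.

Lemma kp_unit_sum n : \sum_(a <- degpaths n) kp_s a * kp_ss a = 1 :> A.
Proof. by rewrite sum_degpaths kp_1E; apply: eq_bigr => v _; rewrite -kp_sum. Qed.

End KPRing.

(** * Non-zero multiples of vertices do not vanish *)

Section NonVanishing.
Local Open Scope quotient_scope.
Variables (R : comPzRingType) (k : nat) (V : countType) (L : kgraph k V).
Hypotheses (Lfin : row_finite L) (Lns : no_sources L).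
Implicit Types (a b l : L) (F : L -> R).

Definition ldiv l a : option L :=
  if pselect (exists b, src l = rng b /\ kcomp l b = a) is left h
  then Some (projT1 (cid h)) else None.

Lemma ldivP l a b : ldiv l a = Some b <-> src l = rng b /\ kcomp l b = a.
Proof.
rewrite /ldiv; case: pselect => [h|nh]; last first.
  by split=> // h; case: nh; exists b.
case: cid => c /= [e1 e2]; split=> [[<-]//|[f1 f2]].
by have [] := kcomp_inj e1 f1 erefl (etrans e2 (esym f2)) => _ ->.
Qed.

Variant ldiv_spec l a : option L -> Prop :=
| LdivSome b of src l = rng b & kcomp l b = a : ldiv_spec l a (Some b)
| LdivNone of (forall b, src l = rng b -> kcomp l b <> a) :
    ldiv_spec l a None.

Lemma ldiv_case l a : ldiv_spec l a (ldiv l a).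
Proof.
case e: (ldiv l a) => [b|]; first by have /ldivP[] := e; constructor.
by constructor=> b e1 e2; have /ldivP := conj e1 e2; rewrite e.
Qed.

Lemma ldiv_comp l b : src l = rng b -> ldiv l (kcomp l b) = Some b.
Proof. by move=> e; apply/ldivP. Qed.

(** The analogue, on finite paths, of the representation by functions on the
    infinite path space: s_l transports a function along the map that
    prepends l. On finite paths (KP4) fails at the paths shorter than n, which
    is why functions are compared up to eveq; all the other relations hold on
    the nose. *)
Fixpoint path_act (t : kpterm R L) F : L -> R :=
  match t with
  | Tp v => fun a => if rng a == v then F a else 0
  | Ts l => fun a => if ldiv l a is Some b then F b else 0
  | Tss l => fun a => if src l == rng a then F (kcomp l a) else 0
  | Tzero => fun=> 0
  | Tadd x y => fun a => path_act x F a + path_act y F a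
  | Topp x => fun a => - path_act x F a
  | Tscale r x => fun a => r * path_act x F a
  | Tmul x y => path_act x (path_act y F)
  end.

Definition eveq F F' := exists N, forall a, vle N (deg a) -> F a = F' a.

Lemma eveq_sym F F' : eveq F F' -> eveq F' F.
Proof. by case=> N h; exists N => a /h. Qed.

Lemma eveq_refl F F' : F =1 F' -> eveq F F'.
Proof. by move=> e; exists 0. Qed.

Lemma eveq_trans F2 F1 F3 : eveq F1 F2 -> eveq F2 F3 -> eveq F1 F3.
Proof.
move=> [N h] [N' h']; exists (N + N') => a Na.
by rewrite h ?h' //; apply: vle_trans Na; rewrite ?vle_addr ?vle_addl.
Qed.

Lemma path_act_eveq t F F' : eveq F F' -> eveq (path_act t F) (path_act t F').
Proof.
elim: t F F' => [v|l|l||x IHx y IHy|x IHx|r x IHx|x IHx y IHy] F F' e /=.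
- by case: e => N h; exists N => a /h ->.
- case: e => N h; exists (deg l + N) => a.
  case: ldiv_case => // b lb <-; rewrite deg_comp // => /vle_cancel; exact: h.
- case: e => N h; exists N => a Na; case: eqP => // la.
  by rewrite h // deg_comp //; apply: vle_trans Na (vle_addl _ _).
- exact: eveq_refl.
- have [[N h] [N' h']] := (IHx _ _ e, IHy _ _ e); exists (N + N') => a Na.
  by rewrite h ?h' //; apply: vle_trans Na; rewrite ?vle_addr ?vle_addl.
- by have [N h] := IHx _ _ e; exists N => a /h ->.
- by have [N h] := IHx _ _ e; exists N => a /h ->.
- exact/IHx/IHy.
Qed.

Lemma path_actD t F F' :
  path_act t (fun a => F a + F' a) = fun a => path_act t F a + path_act t F' a.
Proof.
elim: t F F' => [v|l|l||x IHx y IHy|x IHx|r x IHx|x IHx y IHy] F F' /=;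
  apply/funext => a.
- by case: ifP => _; rewrite ?addr0.
- by case: ldiv => *; rewrite ?addr0.
- by case: ifP => _; rewrite ?addr0.
- by rewrite addr0.
- by rewrite IHx IHy addrACA.
- by rewrite IHx opprD.
- by rewrite IHx mulrDr.
- by rewrite IHy IHx.
Qed.

Lemma path_actZ t r F :
  path_act t (fun a => r * F a) = fun a => r * path_act t F a.
Proof.
elim: t F => [v|l|l||x IHx y IHy|x IHx|r' x IHx|x IHx y IHy] F /=;
  apply/funext => a.
- by case: ifP => _; rewrite ?mulr0.
- by case: ldiv => *; rewrite ?mulr0.
- by case: ifP => _; rewrite ?mulr0.
- by rewrite mulr0.
- by rewrite IHx IHy mulrDr.
- by rewrite IHx mulrN.
- by rewrite IHx mulrCA.
- by rewrite IHy IHx.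
Qed.

(** A path a of degree at least n has a single initial segment of degree n,
    so a single summand does not vanish at a. *)
Lemma path_act_kp4 v n F a : vle n (deg a) ->
  path_act (\big[@Tadd R k V L/Tzero]_(l <- fset_set (paths L v n))
          Tmul (Ts l) (Tss l)) F a = if rng a == v then F a else 0.
Proof.
move=> na.
rewrite (big_morph (fun t => path_act t F a) (id1 := 0) (op1 := +%R)) //=.
have [b [c [bc bca db]]] := kcomp_splitle na.
have mem := @mem_paths _ _ L Lfin v n.
have rb : rng a = rng b by rewrite -bca rng_comp.
have Tb : path_act (Tmul (Ts b) (Tss b)) F a = F a.
  by rewrite /= -bca ldiv_comp // bc eqxx.
have T0 l : deg l = n -> l <> b -> path_act (Tmul (Ts l) (Tss l)) F a = 0.
  move=> dl lb /=; case: ldiv_case => // d ld e; case: lb.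
  by have [] := kcomp_inj ld bc (etrans dl (esym db)) (etrans e (esym bca)).
have [rv|/negbTE rv] := eqVneq (rng a) v.
  rewrite (bigD1_seq b) ?fset_uniq ?mem -?rb ?rv ?db ?eqxx //=.
  rewrite [X in X + _]Tb big_seq_cond big1 ?addr0 // => l.
  by rewrite mem => /andP[/andP[_ /eqP dl] /eqP lb]; apply: T0.
rewrite big_seq big1 // => l; rewrite mem => /andP[/eqP rl /eqP dl].
by apply: T0 => // lb; move: rv; rewrite rb -lb rl eqxx.
Qed.

Lemma path_actP x y : kpeq x y -> forall F, eveq (path_act x F) (path_act y F).
Proof.
elim=> {x y} /=.
- by move=> x F; apply: eveq_refl.
- by move=> x y _ IH F; apply: eveq_sym.
- by move=> x y z _ IH1 _ IH2 F; apply: eveq_trans (IH1 F) (IH2 F).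
- move=> x x' y y' _ IH1 _ IH2 F; have [[N h] [N' h']] := (IH1 F, IH2 F).
  exists (N + N') => a Na.
  by rewrite h ?h' //; apply: vle_trans Na; rewrite ?vle_addr ?vle_addl.
- by move=> x x' _ IH F; have [N h] := IH F; exists N => a /h ->.
- by move=> r x x' _ IH F; have [N h] := IH F; exists N => a /h ->.
- move=> x x' y y' _ IH1 _ IH2 F; apply: eveq_trans (IH1 _).
  exact: path_act_eveq.
- by move=> x y z F; apply: eveq_refl => a; rewrite addrA.
- by move=> x y F; apply: eveq_refl => a; rewrite addrC.
- by move=> x F; apply: eveq_refl => a; rewrite add0r.
- by move=> x F; apply: eveq_refl => a; rewrite addNr.
- by move=> r t x F; apply: eveq_refl => a; rewrite mulrA.
- by move=> x F; apply: eveq_refl => a; rewrite mul1r.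
- by move=> r x y F; apply: eveq_refl => a; rewrite mulrDr.
- by move=> r t x F; apply: eveq_refl => a; rewrite mulrDl.
- by move=> x y z F; apply: eveq_refl.
- by move=> x y z F; apply: eveq_refl.
- by move=> x y z F; apply: eveq_refl => a; rewrite path_actD.
- by move=> r x y F; apply: eveq_refl.
- by move=> r x y F; apply: eveq_refl => a; rewrite path_actZ.
- move=> v F; apply: eveq_refl => a; case: ldiv_case => [b|h].
    by rewrite src_idm => -> <-; rewrite comp_idl eqxx.
  by case: eqP => // e; case: (h a); rewrite ?src_idm -?e ?comp_idl.
- move=> v F; apply: eveq_refl => a; rewrite src_idm eq_sym.
  by case: eqP => // <-; rewrite comp_idl.
- by move=> v F; apply: eveq_refl => a; case: eqP.
- move=> v w vw F; apply: eveq_refl => a.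
  by case: eqP => // ->; case: eqP.
- move=> l m lm F; apply: eveq_refl => a.
  have slm b : src (kcomp l m) = rng b -> src m = rng b by rewrite src_comp.
  case: ldiv_case => [b lb <-|h].
    case: ldiv_case => [c mc eb|h].
      by rewrite -eb comp_assoc // ldiv_comp // src_comp.
    case: ldiv_case => // c /slm mc; rewrite -comp_assoc // => e.
    have [] := kcomp_inj _ lb erefl e; first by rewrite rng_comp.
    by move=> _ e'; case: (h c).
  case: ldiv_case => // c /slm mc; rewrite -comp_assoc // => e.
  by case: (h (kcomp m c)); rewrite // rng_comp.
- move=> l m lm F; apply: eveq_refl => a; rewrite src_comp //.
  by case: eqP => // ma; rewrite rng_comp // lm eqxx comp_assoc.
- move=> l F; apply: eveq_refl => a.
  case: ldiv_case => [b lb <-|h]; last by case: ifP.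
  by rewrite rng_comp // eqxx.
- move=> l F; apply: eveq_refl => a.
  by case: ldiv_case => // b <-; rewrite eqxx.
- by move=> l F; apply: eveq_refl => a; rewrite eq_sym; case: eqP.
- move=> l F; apply: eveq_refl => a; case: eqP => // la.
  by rewrite rng_comp ?eqxx.
- move=> l F; apply: eveq_refl => a; rewrite eq_sym; case: eqP => // la.
  by rewrite ldiv_comp.
- move=> l m dlm lm F; apply: eveq_refl => a; case: eqP => // la.
  by case: ldiv_case => // b mb e; case: lm; have [] := kcomp_inj mb la _ e.
- move=> v n _ F; exists n => a na; by rewrite path_act_kp4.
Qed.

(** The class r p_v sends the constant function 1 to a function that takes
    the value r on all paths with range v; without sources there are
    arbitrarily long ones. *)
Lemma kp_pZ_eq0 (r : R) (v : V) : r *: kp_p L v = 0 :> KP R L -> r = 0.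
Proof.
move=> e.
have /kp_piP /path_actP /(_ (fun=> 1)) [N h] :
    \pi_(KP R L) (Tscale r (Tp v)) = \pi_(KP R L) Tzero.
  by rewrite -kp_scaleE.
have [a [/= ra da]] := Lns v N.
by have := h a; rewrite /= da ra eqxx mulr1 => /(_ (vle_refl _)).
Qed.

End NonVanishing.

(** * Uniqueness for aperiodic graphs *)

Section Uniqueness.
Variables (R : comPzRingType) (k : nat) (V : finType) (L : kgraph k V).
Local Notation A := (KP R L).
Implicit Types (a b : L) (x y : A).

(** Elements free of ghost generators. The bound on the degrees is what lets
    ghost_absorption be iterated, and the common source what lets all terms be
    multiplied by the same path. *)
Definition in_span (M : natvec k) w x :=
  exists (D : {fset L}) (r : L -> R),
    x = \sum_(a <- D) r a *: (kp_s a : A) /\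
    forall a, a \in D -> vle M (deg a) /\ src a = w.

Lemma in_span0 M w : in_span M w 0.
Proof. by exists fset0, (fun=> 0); rewrite big_seq_fset0. Qed.

Lemma in_span_s M a : vle M (deg a) -> in_span M (src a) (kp_s a).
Proof.
move=> Ma; exists [fset a]%fset, (fun=> 1).
rewrite big_seq_fset1 scale1r; split=> // b; by rewrite inE => /eqP ->.
Qed.

Lemma in_spanZ M w (t : R) x : in_span M w x -> in_span M w (t *: x).
Proof.
move=> [D [r [-> h]]]; exists D, (fun a => t * r a); split=> //.
by rewrite scaler_sumr; apply: eq_bigr => a _; rewrite scalerA.
Qed.

Lemma in_spanD M w x y : in_span M w x -> in_span M w y -> in_span M w (x + y).
Proof.
move=> [D [r [-> h]]] [D' [r' [-> h']]].
exists (D `|` D')%fset.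
exists (fun a => (if a \in D then r a else 0) + (if a \in D' then r' a else 0)).
split; last by move=> a; rewrite inE => /orP[/h|/h'].
have cover (E : {fset L}) (t : L -> R) : (E `<=` D `|` D')%fset ->
    \sum_(a <- E) t a *: (kp_s a : A) =
    \sum_(a <- (D `|` D')%fset) (if a \in E then t a else 0) *: (kp_s a : A).
  move=> sE; rewrite -(big_fset_incl _ sE) //=.
    by rewrite big_seq [RHS]big_seq; apply: eq_bigr => a ->.
  by move=> a _ /negbTE ->; rewrite scale0r.
rewrite (cover D) ?fsubsetUl // (cover D') ?fsubsetUr // -big_split /=.
by apply: eq_bigr => a _; rewrite scalerDl.
Qed.

(** Right multiplication by a long path eliminates the ghost generators: each
    s_a^* cancels against the beginning of the path. This spares the normal
    form with all products s_a s_b^*. The bound M makes the induction go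
    through products, where the outer factor meets the paths left over by the
    inner one, which must still be long. *)
Lemma ghost_absorption x M :
  exists N, forall b, vle N (deg b) -> in_span M (src b) (x * kp_s b).
Proof.
elim/kp_ind: x M => [v|a|a||x y IHx IHy|x IHx|r x IHx|x y IHx IHy] M.
- exists M => b Mb; rewrite -kp_idm kp_sM src_idm.
  case: eqP => [->|_]; last exact: in_span0.
  by rewrite comp_idl; apply: in_span_s.
- exists M => b Mb; rewrite kp_sM; case: eqP => [e|_]; last exact: in_span0.
  rewrite -(src_comp e); apply: in_span_s; rewrite deg_comp //.
  exact: vle_trans Mb (vle_addl _ _).
- exists (deg a + M) => b Mb.
  have [c [d [cd bE dc]]] := kcomp_splitle (vle_trans (vle_addr _ _) Mb).
  rewrite -{}bE in Mb *.
  have -> : kp_s (kcomp c d) = kp_s c * kp_s d :> A by rewrite kp_sM cd eqxx.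
  rewrite mulrA kp_sss ?dc // src_comp //.
  case: eqP => [e|_]; last by rewrite mul0r; apply: in_span0.
  rewrite e cd -kp_idm kp_sM src_idm eqxx comp_idl; apply: in_span_s.
  by move: Mb; rewrite deg_comp // dc; apply: vle_cancel.
- by exists 0 => b _; rewrite mul0r; apply: in_span0.
- have [[N h] [N' h']] := (IHx M, IHy M); exists (N + N') => b Nb.
  rewrite mulrDl; apply: in_spanD; [apply: h | apply: h'];
    by apply: vle_trans Nb; rewrite ?vle_addr ?vle_addl.
- have [N h] := IHx M; exists N => b /h.
  by rewrite mulNr -scaleN1r; apply: in_spanZ.
- have [N h] := IHx M; exists N => b /h.
  by rewrite kp_mulZl; apply: in_spanZ.
- have [N h] := IHx M; have [N' h'] := IHy N; exists N' => b /h'.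
  rewrite -mulrA => -[D [r [-> hD]]]; rewrite mulr_sumr big_seq.
  elim/big_ind: _ => [||a aD]; [exact: in_span0 | by move=> *; apply: in_spanD|].
  have [Na <-] := hD a aD.
  by rewrite kp_mulZr; apply/in_spanZ/h.
Qed.

Hypothesis Lfin : row_finite L.

(** Insert the unit, as the sum of s_d s_d^* over all d of degree
    deg b + deg c, between s_b^* and s_c: the summand of d survives only if d
    extends both b and c. *)
Lemma kp_ss_s_disjoint b c :
  (forall b' c', src b = rng b' -> src c = rng c' ->
     kcomp b b' <> kcomp c c') -> kp_ss b * kp_s c = 0 :> A.
Proof.
move=> bc; rewrite -[kp_s c]mul1r -(kp_unit_sum _ Lfin (deg b + deg c)).
rewrite mulr_suml mulr_sumr big_seq big1 // => d; rewrite mem_degpaths //.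
move=> /eqP dd; have [b1 [b2 [e1 e2 e3 _]]] := kcomp_split dd.
rewrite addrC in dd; have [c1 [c2 [f1 f2 f3 _]]] := kcomp_split dd.
rewrite -[in kp_s d]e2 -f2.
have -> : kp_s (kcomp b1 b2) = kp_s b1 * kp_s b2 :> A by rewrite kp_sM e1 eqxx.
have -> : kp_ss (kcomp c1 c2) = kp_ss c2 * kp_ss c1 :> A.
  by rewrite kp_ssM f1 eqxx.
rewrite -!mulrA kp_sss // !mulrA kp_sss //.
case: eqP => [bb|_]; last by rewrite !mul0r.
case: eqP => [cc|_]; last by rewrite !mulr0.
case: (bc b2 c2); rewrite ?bb -?cc //.
by rewrite e2 f2.
Qed.

Section Separation.
Variable x : infpath L.

(** The finite part of x of degree N already shows that the shifts of x by m
    and by n differ. *)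
Definition separates N m n := exists p q (pq : vle p q),
  [/\ vle (q + m) N, vle (q + n) N &
      imor x (vle_add2r n pq) <> imor x (vle_add2r m pq)].

Lemma separates_le N N' m n : vle N N' -> separates N m n -> separates N' m n.
Proof.
move=> NN' [p [q [pq [h1 h2 h3]]]]; exists p, q, pq.
by split=> //; apply: vle_trans NN'.
Qed.

Lemma separates_ex m n : shift m x <> shift n x -> exists N, separates N m n.
Proof.
move=> mn; apply: contrapT => /forallNP h; apply: mn.
apply: infpath_ext => p q pq /=; apply: contrapT => e.
case: (h (q + m + (q + n))); exists p, q, pq.
split; rewrite ?vle_addr ?vle_addl //; by move/esym.
Qed.

Lemma separates_all m (s : seq (natvec k)) :
  (forall m n : natvec k, m <> n -> shift m x <> shift n x) ->
  exists N, forall n, n \in s -> m <> n -> separates N m n.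
Proof.
move=> ap; elim: s => [|n s [N h]]; first by exists 0.
have [N' h'] : exists N', m <> n -> separates N' m n.
  have [->|/eqP mn] := eqVneq m n; first by exists 0.
  by have [N' h'] := separates_ex (ap m n mn); exists N'.
exists (N + N') => n'; rewrite inE => /orP[/eqP ->|n's] mn.
  by apply: separates_le (h' mn); apply: vle_addl.
by apply: separates_le (h n' n's mn); apply: vle_addr.
Qed.

Lemma vle0 (N : natvec k) : vle 0 N.
Proof. by apply/forallP => i; rewrite ffunE. Qed.

Lemma imor_cut p q t (pq : vle p q) (qt : vle q t) (pt : vle p t) :
  imor x pt = kcomp (imor x pq) (imor x qt).
Proof. by rewrite -imor_comp; congr imor; apply: bool_irrelevance. Qed.

Lemma deg_imor0 p (h : vle 0 p) : deg (imor x h) = p.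
Proof. by rewrite deg_imor; apply/ffunP => i; rewrite !ffunE subn0. Qed.

(** If both a x(0,N) and b x(0,N) could be extended to one path, the piece of
    that path starting in degree deg a + deg b + p and ending in degree
    deg a + deg b + q would be a piece of x shifted by deg b, and also a piece
    of x shifted by deg a. *)
Lemma separates_disjoint N a b : separates N (deg a) (deg b) ->
  src a = ivtx x 0 -> src b = ivtx x 0 ->
  forall a' b', src (kcomp a (imor x (vle0 N))) = rng a' ->
    src (kcomp b (imor x (vle0 N))) = rng b' ->
    kcomp (kcomp a (imor x (vle0 N))) a' <> kcomp (kcomp b (imor x (vle0 N))) b'.
Proof.
move=> [p [q [pq [aN bN ne]]]] sa sb a' b'.
rewrite !src_comp ?rng_imor // => Na' Nb' e; apply: ne.
have cut (c c' : L) n (nN : vle (q + n) N) :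
    src c = ivtx x 0 -> src (imor x (vle0 N)) = rng c' ->
    let u := imor x (vle0 (p + n)) in let w := imor x (vle_add2r n pq) in
    let z := imor x nN in
    [/\ src (kcomp c u) = rng (kcomp w (kcomp z c')),
        deg (kcomp c u) = deg c + (p + n), src w = rng (kcomp z c') &
        kcomp (kcomp c (imor x (vle0 N))) c' =
        kcomp (kcomp c u) (kcomp w (kcomp z c'))].
  move=> sc; rewrite src_imor => Nc' u w z.
  have sz : src z = rng c' by rewrite src_imor.
  have sw : src w = rng z by rewrite src_imor rng_imor.
  have su : src u = rng w by rewrite src_imor rng_imor.
  have scu : src c = rng u by rewrite sc rng_imor.
  have swz : src w = rng (kcomp z c') by rewrite rng_comp.
  split=> //.
  - by rewrite src_comp // rng_comp.
  - by rewrite deg_comp // deg_imor0.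
  rewrite (imor_cut (vle0 (q + n)) nN) (imor_cut (vle0 (p + n)) (vle_add2r n pq)).
  rewrite -/u -/w -/z.
  by rewrite -!comp_assoc ?src_comp ?rng_comp // ?src_comp.
have [h1 h2 h3 h4] := cut a a' (deg b) bN sa Na'.
have [g1 g2 g3 g4] := cut b b' (deg a) aN sb Nb'.
have [|_ e'] := kcomp_inj h1 g1 _ (etrans (esym h4) (etrans e g4)).
  by rewrite h2 g2 addrCA [RHS]addrCA (addrC (deg a)).
have [] // := kcomp_inj h3 g3 _ e'.
rewrite !deg_imor; apply/ffunP => i.
by rewrite !ffunE !subnDr.
Qed.

End Separation.

(** The Cuntz-Krieger uniqueness theorem. A non-zero x in I stays non-zero
    after multiplication by some long s_b, and then is a combination of paths
    only; compressing it by s_(a0 c)^* on the left and s_c on the right, with c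
    a long piece of an aperiodic path, leaves the coefficient of a0. *)
Lemma kp_uniqueness (I : A -> Prop) : aperiodic L ->
  (forall x y, I y -> I (x * y)) -> (forall x y, I x -> I (x * y)) ->
  forall x, I x -> x <> 0 -> exists (r : R) v, r <> 0 /\ I (r *: kp_p L v).
Proof.
move=> Lap Il Ir x Ix x0.
have [N hN] := ghost_absorption x 0.
have [b bN xb] : exists2 b, deg b = N & x * kp_s b <> 0.
  apply: contrapT => h; apply: x0.
  rewrite -[x]mulr1 -(kp_unit_sum _ Lfin N) mulr_sumr big_seq big1 // => b.
  rewrite mem_degpaths // => /eqP bN; rewrite mulrA.
  suff -> : x * kp_s b = 0 by rewrite mul0r.
  by apply: contrapT => xb; apply: h; exists b.
have [|D [r [e hD]]] := hN b; first by rewrite bN vle_refl.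
have Iy := Ir _ (kp_s b) Ix; rewrite {}e in Iy xb.
have [a0 a0D ra0] : exists2 a, a \in D & r a <> 0.
  apply: contrapT => h; apply: xb; rewrite big_seq big1 // => a aD.
  suff -> : r a = 0 by rewrite scale0r.
  by apply: contrapT => ra; apply: h; exists a.
have [z [zb zap]] := Lap (src b).
have [N' hN'] := separates_all (deg a0) [seq deg a | a <- D] zap.
pose c := imor z (vle0 N').
have sD a : a \in D -> src a = rng c by move=> /hD[_ ->]; rewrite rng_imor zb.
exists (r a0), (src c); split=> //.
suff <- : kp_ss (kcomp a0 c) * (\sum_(a <- D) r a *: (kp_s a : A)) * kp_s c
    = r a0 *: kp_p L (src c) by apply/Ir/Il.
rewrite -mulrA mulr_suml mulr_sumr.
(* The other terms vanish: those of the degree of a0 by (KP3), the rest since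
   a0 c and a c have no common extension. *)
have term a : a \in D ->
    kp_ss (kcomp a0 c) * (r a *: (kp_s a : A) * kp_s c) =
    if a == a0 then r a0 *: kp_p L (src c) else 0.
  move=> aD; rewrite kp_mulZl kp_mulZr kp_sM sD // eqxx.
  case: eqP => [->|ne].
    by rewrite kp_sss // eqxx src_comp // sD.
  have [da|/eqP da] := eqVneq (deg a0) (deg a).
    rewrite kp_sss; last by rewrite !deg_comp ?sD // da.
    case: eqP => [e|_]; last by rewrite scaler0.
    case: ne; have [] := kcomp_inj (sD _ a0D) (sD _ aD) da e; by move=> ->.
  rewrite kp_ss_s_disjoint ?scaler0 //; apply: separates_disjoint.
  - by apply: hN' => //; apply/mapP; exists a.
  - by rewrite zb; case: (hD a0).
  - by rewrite zb; case: (hD a).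
rewrite (bigD1_seq a0) ?fset_uniq //= term // eqxx big_seq_cond big1 ?addr0 //.
by move=> a /andP[aD /negbTE ne]; rewrite term // ne.
Qed.

End Uniqueness.

(** * Ideals over cofinal graphs *)

Section Cofinality.
Variables (R : comPzRingType) (k : nat) (V : finType) (L : kgraph k V).
Hypothesis Lfin : row_finite L.
Local Notation A := (KP R L).

(** Call a vertex u good if r p_u is outside I. By (KP4) a good vertex has a
    path of degree (1, ..., 1) to a good vertex, so a good vertex would start
    an infinite path along which good vertices remain reachable. Cofinality
    connects v to this path, whereas vertices reachable from v are not
    good. *)
Lemma kp_cofinal (I : A -> Prop) (r : R) (v : V) : cofinal L ->
  I 0 -> (forall x y, I x -> I y -> I (x + y)) ->
  (forall x y, I y -> I (x * y)) -> (forall x y, I x -> I (x * y)) ->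
  I (r *: kp_p L v) -> forall w, I (r *: kp_p L w).
Proof.
move=> Lcof I0 ID Il Ir Iv w.
have hered (a : L) : I (r *: kp_p L (rng a)) -> I (r *: kp_p L (src a)).
  move=> Ia; have := Il (kp_ss a) _ (Ir _ (kp_s a) Ia).
  by rewrite kp_mulZl kp_mulZr kp_rs kp_sss // eqxx.
pose good u := ~ I (r *: kp_p L u).
pose step u (a : L) := [/\ rng a = u, deg a = vconst k 1 & good (src a)].
have hstep u : good u -> exists a, step u a.
  move=> gu; apply: contrapT => /forallNP h; apply: gu.
  rewrite (kp_sum _ Lfin u (vconst k 1)) scaler_sumr big_seq.
  elim/big_ind: _ => // a; rewrite mem_paths // => /andP[/eqP ra /eqP da].
  have Ia : I (r *: kp_p L (src a)).
    by apply: contrapT => ga; apply: (h a).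
  have := Il (kp_s a) _ (Ir _ (kp_ss a) Ia).
  by rewrite kp_mulZl kp_mulZr kp_rss.
pose nxt u : L :=
  if pselect (exists a, step u a) is left h then projT1 (cid h) else idm u.
apply: contrapT => gw.
have [||x xP] := @infpath_of_steps _ _ L nxt good w => //.
  move=> u /hstep h; rewrite /nxt; case: pselect => // h'.
  by case: cid.
have [n [a [ra sa]]] := Lcof v x.
have [b [rb gb]] := xP n.
by apply/gb/hered; rewrite rb -sa; apply: hered; rewrite ra.
Qed.

End Cofinality.

(** * Paths of the pullback *)

Section PullbackPaths.
Variables (k l : nat) (f : {additive natvec k -> natvec l}).
Variables (V : countType) (G : kgraph l V).
Hypothesis Gfin : row_finite G.
Local Notation L := (pullback f G).

Lemma val_pullback (x : L) : val x = ((val x).1, deg x).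
Proof. exact: surjective_pairing. Qed.

Lemma deg_pullback (x : L) : deg (val x).1 = f (deg x).
Proof. exact/eqP/(valP x). Qed.

Lemma pullback_inj (x y : L) : (val x).1 = (val y).1 -> deg x = deg y -> x = y.
Proof. by move=> e d; apply: val_inj; rewrite val_pullback e d -val_pullback. Qed.

Lemma val_pullback_comp (x y : L) : src x = rng y ->
  (val (kcomp x y)).1 = kcomp (val x).1 (val y).1.
Proof. by move=> xy; rewrite (val_pb_comp xy). Qed.

Lemma pullback_lift (a : G) n : deg a = f n ->
  exists x : L, (val x).1 = a /\ deg x = n.
Proof. by move=> e; exists (exist _ (a, n) (introT eqP e)). Qed.

Lemma pullback_row_finite : row_finite L.
Proof.
move=> v n.
apply: sub_finite_set
  (finite_image (fun a => insubd (idm v : L) (a, n)) (Gfin v (f n))) => x.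
move=> [rx dx]; exists (val x).1; first by split; rewrite // deg_pullback dx.
by rewrite -dx -val_pullback valKd.
Qed.

(** The paths of degree n in the pullback are the pairs (a, n) with a of
    degree f n. *)
Lemma sum_pullback (M : nmodType) (F : G -> M) v n :
  \sum_(x <- fset_set (paths L v n)) F (val x).1 =
  \sum_(a <- fset_set (paths G v (f n))) F a.
Proof.
rewrite -(big_map (fun x : L => (val x).1) xpredT).
apply/perm_big/uniq_perm; rewrite ?fset_uniq //.
  rewrite map_inj_in_uniq ?fset_uniq // => x y.
  rewrite !mem_paths //; try exact: pullback_row_finite.
  by move=> /andP[_ /eqP dx] /andP[_ /eqP dy] e; apply: pullback_inj; rewrite ?dx.
move=> a; rewrite mem_paths //; apply/mapP/andP => [[x]|[/eqP ra /eqP da]].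
  rewrite mem_paths; last exact: pullback_row_finite.
  by move=> /andP[/eqP <- /eqP <-] ->; rewrite deg_pullback.
have [x [xa dx]] := pullback_lift da; exists x => //.
rewrite mem_paths; last exact: pullback_row_finite.
by rewrite dx -ra -xa !eqxx.
Qed.

End PullbackPaths.

(** * The central units U_h *)

Section Iota.
Variables (K : fieldType) (k l : nat) (f : {additive natvec k -> natvec l}).
Variables (V : finType) (G : kgraph l V).
Hypothesis Gfin : row_finite G.
Local Notation L := (pullback f G).
Local Notation A := (KP K L).
Local Notation ps := (@pb_s K k l f V G).
Local Notation pss := (@pb_ss K k l f V G).
Implicit Types (a b : G) (m n p : natvec k) (h : kerbar f).

Lemma pb_sE (x : L) : ps (val x).1 (deg x) = kp_s x.
Proof. by rewrite /pb_s -val_pullback valK. Qed.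

Lemma pb_ssE (x : L) : pss (val x).1 (deg x) = kp_ss x.
Proof. by rewrite /pb_ss -val_pullback valK. Qed.

Lemma pb_sM a b m n : deg a = f m -> deg b = f n ->
  ps a m * ps b n = if src a == rng b then ps (kcomp a b) (m + n) else 0.
Proof.
move=> /pullback_lift[x [<- <-]] /pullback_lift[y [<- <-]].
rewrite !pb_sE kp_sM; case: eqP => // xy.
by rewrite -pb_sE deg_comp // val_pullback_comp.
Qed.

Lemma pb_ssM a b m n : deg a = f m -> deg b = f n ->
  pss b n * pss a m = if src a == rng b then pss (kcomp a b) (m + n) else 0.
Proof.
move=> /pullback_lift[x [<- <-]] /pullback_lift[y [<- <-]].
rewrite !pb_ssE kp_ssM; case: eqP => // xy.
by rewrite -pb_ssE deg_comp // val_pullback_comp.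
Qed.

Lemma pb_sss a b n : deg a = f n -> deg b = f n ->
  pss a n * ps b n = if a == b then kp_p L (src a) else 0.
Proof.
move=> /pullback_lift[x [<- <-]] /pullback_lift[y [<- dy]].
rewrite -dy pb_sE dy pb_ssE kp_sss //.
case: eqP => [->|xy]; first by rewrite eqxx.
by case: eqP => // e; case: xy; apply: pullback_inj.
Qed.

Lemma pb_sr a n : deg a = f n -> ps a n * kp_p L (src a) = ps a n.
Proof. by move=> /pullback_lift[x [<- <-]]; rewrite pb_sE -[RHS]kp_sr. Qed.

Lemma pb_rss a n : deg a = f n -> kp_p L (src a) * pss a n = pss a n.
Proof. by move=> /pullback_lift[x [<- <-]]; rewrite pb_ssE -[RHS]kp_rss. Qed.

Lemma pb_idm v : ps (idm v) 0 = kp_p L v.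
Proof. by rewrite -kp_idm -pb_sE deg_idm. Qed.

Lemma pb_gidm v : pss (idm v) 0 = kp_p L v.
Proof. by rewrite -kp_gidm -pb_ssE deg_idm. Qed.

Lemma pb_sum v n :
  \sum_(a <- fset_set (paths G v (f n))) ps a n * pss a n = kp_p L v.
Proof.
rewrite -sum_pullback // (kp_sum _ (pullback_row_finite f Gfin) v n).
rewrite big_seq [RHS]big_seq; apply: eq_bigr => x.
rewrite mem_paths; last exact: pullback_row_finite.
by move=> /andP[_ /eqP <-]; rewrite pb_sE pb_ssE.
Qed.

Lemma pb_unit_sum n : \sum_(a <- degpaths G (f n)) ps a n * pss a n = 1.
Proof.
by rewrite sum_degpaths // kp_1E; apply: eq_bigr => v _; rewrite pb_sum.
Qed.

(** A presentation of U_h for any way to write h = m - n with natural vectors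
    m and n such that f m = f n, instead of the positive and negative parts.
    This flexibility is what makes the products U_g U_h easy to compute. *)
Definition twist m n : A := \sum_(a <- degpaths G (f m)) ps a m * pss a n.

Lemma twist_s m n a : f m = f n -> deg a = f n -> twist m n * ps a n = ps a m.
Proof.
move=> mn da; rewrite /twist mulr_suml (bigD1_seq a) ?fset_uniq //=; last first.
  by rewrite mem_degpaths // mn da.
rewrite -mulrA pb_sss // eqxx pb_sr ?mn // big_seq_cond big1 ?addr0 // => b.
rewrite mem_degpaths // => /andP[/eqP db /negbTE ba].
by rewrite -mulrA pb_sss // ba mulr0.
Qed.

Lemma ss_twist m n a : f m = f n -> deg a = f m -> pss a m * twist m n = pss a n.
Proof.
move=> mn da; rewrite /twist mulr_sumr (bigD1_seq a) ?fset_uniq //=; last first.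
  by rewrite mem_degpaths // da.
rewrite mulrA pb_sss // eqxx pb_rss -?mn // big_seq_cond big1 ?addr0 // => b.
rewrite mem_degpaths // => /andP[/eqP db /negbTE ba].
by rewrite mulrA pb_sss // eq_sym ba mul0r.
Qed.

(** Cut a after degree f n; the twist acts on the first part. *)
Lemma twist_s_add m n p a : f m = f n -> deg a = f (n + p) ->
  twist m n * ps a (n + p) = ps a (m + p).
Proof.
move=> mn; rewrite raddfD => /kcomp_split[b [c [bc <- db dc]]].
have e q : f q = f n -> ps (kcomp b c) (q + p) = ps b q * ps c p.
  by move=> qn; rewrite pb_sM ?bc ?eqxx // qn.
by rewrite !e // mulrA twist_s.
Qed.

(** Both sides agree on every s_(a, n + p), and 1 is the sum of the
    s_(a, n + p) s_(a, n + p)^*. *)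
Lemma twist_add m n p : f m = f n -> twist (m + p) (n + p) = twist m n.
Proof.
move=> mn; rewrite -[RHS]mulr1 -(pb_unit_sum (n + p)) mulr_sumr.
have -> : f (n + p) = f (m + p) by rewrite !raddfD mn.
rewrite /twist big_seq [RHS]big_seq; apply: eq_bigr => a.
rewrite mem_degpaths // => /eqP da.
by rewrite mulrA twist_s_add // da !raddfD mn.
Qed.

(** After moving both factors to a common middle degree, n + m', the first
    one replaces that degree by m + m' in every summand of the second. *)
Lemma twistM m n m' n' : f m = f n -> f m' = f n' ->
  twist m n * twist m' n' = twist (m + m') (n + n').
Proof.
move=> mn mn'; rewrite -(twist_add m' mn) -(twist_add n mn') (addrC m' n).
rewrite [in X in _ * X]/twist mulr_sumr.
have -> : f (n + m') = f (m + m') by rewrite !raddfD mn.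
rewrite [RHS]/twist big_seq [RHS]big_seq; apply: eq_bigr => a.
rewrite mem_degpaths // => /eqP da.
by rewrite mulrA twist_s ?(addrC n') // ?da !raddfD mn.
Qed.

Lemma twist_central_s m n p a : f m = f n -> deg a = f p ->
  twist m n * ps a p = ps a p * twist m n.
Proof.
move=> mn da; rewrite -[LHS]mulr1 -(pb_unit_sum n) [in RHS]/twist !mulr_sumr -mn.
rewrite big_seq [RHS]big_seq; apply: eq_bigr => b.
rewrite mem_degpaths // => /eqP db.
rewrite !mulrA; congr (_ * _); rewrite -mulrA !pb_sM -?mn //.
case: eqP => [ab|_]; last by rewrite mulr0.
by rewrite addrC twist_s_add ?(addrC m) // deg_comp // da db raddfD mn addrC.
Qed.

(** Expand 1 on the right in degree p; commuting the twist past s_(b, p)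
    exposes s_(a, p)^* s_(b, p), which is zero unless b = a. *)
Lemma twist_central_ss m n p a : f m = f n -> deg a = f p ->
  twist m n * pss a p = pss a p * twist m n.
Proof.
move=> mn da; rewrite -[RHS]mulr1 -(pb_unit_sum p) mulr_sumr.
rewrite (bigD1_seq a) ?fset_uniq ?mem_degpaths ?da //=.
have tm b : deg b = f p -> pss a p * twist m n * (ps b p * pss b p)
    = pss a p * ps b p * twist m n * pss b p.
  by move=> db; rewrite !mulrA -(mulrA _ (twist m n)) twist_central_s // !mulrA.
rewrite tm // pb_sss // eqxx big_seq_cond big1 ?addr0 => [|b]; last first.
  rewrite mem_degpaths // => /andP[/eqP db /negbTE ba].
  by rewrite tm // pb_sss // eq_sym ba !mul0r.
by rewrite -pb_idm -twist_central_s ?deg_idm ?raddf0 // pb_idm -mulrA pb_rss.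
Qed.

Lemma twist_central m n x : f m = f n -> twist m n * x = x * twist m n.
Proof.
move=> mn; elim/kp_ind: x => [v|x|x||x y IHx IHy|x IHx|r x IHx|x y IHx IHy].
- by rewrite -pb_idm twist_central_s ?deg_idm ?raddf0.
- by rewrite -pb_sE twist_central_s ?deg_pullback.
- by rewrite -pb_ssE twist_central_ss ?deg_pullback.
- by rewrite mulr0 mul0r.
- by rewrite mulrDr mulrDl IHx IHy.
- by rewrite mulrN mulNr IHx.
- by rewrite kp_mulZl kp_mulZr IHx.
- by rewrite mulrA IHx -mulrA IHy mulrA.
Qed.

Lemma kerbar_eq h : f (vpos (val h)) = f (vneg (val h)).
Proof.
have /eqP/ffunP e := valP h; apply/ffunP => i.
by move: (e i); rewrite !ffunE => /eqP; rewrite subr_eq0 => /eqP[].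
Qed.

Lemma Uker_posneg h : Uker K G h = twist (vpos (val h)) (vneg (val h)).
Proof.
rewrite /Uker /twist sum_degpaths //; apply: eq_bigr => v _.
by rewrite fsbig_finite //; exact: Gfin.
Qed.

Lemma vint_inj : injective (@vint k).
Proof.
by move=> p q /ffunP e; apply/ffunP => i; move: (e i); rewrite !ffunE => -[].
Qed.

Lemma vintD (p q : natvec k) : vint (p + q) = vint p + vint q.
Proof. by apply/ffunP => i; rewrite !ffunE. Qed.

Lemma UkerE h m n : val h = vint m - vint n -> Uker K G h = twist m n.
Proof.
move=> hE; have e : vpos (val h) + n = vneg (val h) + m.
  apply: vint_inj; rewrite !vintD; move: (vposnegE (val h)).
  rewrite {1}hE => /eqP; rewrite subr_eq addrAC eq_sym subr_eq => /eqP ->.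
  by rewrite addrC.
have mn : f m = f n.
  apply: (@natvec_addI _ (f (vneg (val h)))).
  by rewrite -raddfD -e raddfD kerbar_eq.
rewrite Uker_posneg -(twist_add n (kerbar_eq h)) e.
by rewrite addrC [X in twist _ X]addrC twist_add.
Qed.

Lemma Uker0 : Uker K G (0 : kerbar f) = 1.
Proof.
by rewrite (@UkerE 0 0 0) ?subrr // /twist pb_unit_sum.
Qed.

Lemma UkerD h h' : Uker K G (h + h') = Uker K G h * Uker K G h'.
Proof.
rewrite !Uker_posneg twistM; try exact: kerbar_eq.
rewrite -Uker_posneg; apply: UkerE => /=.
by rewrite !vintD {1}(vposnegE (val h)) {1}(vposnegE (val h')) opprD addrACA.
Qed.

Lemma Uker_central h x : Uker K G h * x = x * Uker K G h.
Proof. by rewrite Uker_posneg twist_central // kerbar_eq. Qed.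

Local Notation C := (galg K (kerbar f)).
Local Notation iota := (@iota_gal K k l f V G).

Lemma iota_wide (D : {fset kerbar f}) (c : C) : (msupp c `<=` D)%fset ->
  iota c = \sum_(h <- D) c@_h *: Uker K G h.
Proof.
move=> sD; rewrite /iota_gal (big_fset_incl _ sD) // => h _ /mcoeff_outdom ->.
by rewrite scale0r.
Qed.

Lemma iota_zmod : zmod_morphism iota.
Proof.
move=> c d; rewrite (iota_wide (msuppB_le c d)).
rewrite (iota_wide (fsubsetUl (msupp c) (msupp d))).
rewrite (iota_wide (fsubsetUr (msupp c) (msupp d))) -sumrB.
by apply: eq_bigr => h _; rewrite mcoeffB scalerBl.
Qed.

Lemma iota_mkU (r : K) h : iota << r *g h >> = r *: Uker K G h.
Proof. by rewrite (iota_wide msuppU_le) big_seq_fset1 mcoeffUU. Qed.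

Definition iota_additive : {additive C -> A} :=
  HB.pack iota (GRing.isZmodMorphism.Build C A iota iota_zmod).

Lemma iota_monoid : monoid_morphism iota.
Proof.
split=> [|c d]; first by rewrite [1]/(<< 1 *g 0 >> : C) iota_mkU Uker0 scale1r.
rewrite [c * d]/(galg_mul c d) /galg_mul -[iota]/(iota_additive : _ -> _).
rewrite raddf_sum /= {2}/iota_gal mulr_suml; apply: eq_bigr => g _.
rewrite -[iota]/(iota_additive : _ -> _) raddf_sum /= {2}/iota_gal mulr_sumr.
apply: eq_bigr => h _.
by rewrite iota_mkU UkerD kp_mulZl kp_mulZr scalerA.
Qed.

Definition iota_rmorphism : {rmorphism C -> A} :=
  HB.pack iota (GRing.isZmodMorphism.Build C A iota iota_zmod)
    (GRing.isMonoidMorphism.Build C A iota iota_monoid).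

Lemma iota_central (c : C) x : iota c * x = x * iota c.
Proof.
rewrite /iota_gal mulr_suml mulr_sumr; apply: eq_bigr => h _.
by rewrite kp_mulZl kp_mulZr Uker_central.
Qed.

End Iota.

(** * Ideals, quotients and group algebras *)

Local Open Scope classical_set_scope.

Section MakeIdeal.
Variables (R : pzRingType) (S : R -> bool).
Hypothesis S_zmod : zmod_closed S.
Hypothesis S_mull : forall a x, x \in S -> a * x \in S.
Hypothesis S_mulr : forall a x, x \in S -> x * a \in S.

Definition mk_ideal : ideal R :=
  HB.pack S (GRing.isZmodClosed.Build R S S_zmod)
    (isTwoSided.Build R S S_mull S_mulr).

Lemma mem_mk_ideal x : (x \in mk_ideal) = S x. Proof. by []. Qed.

End MakeIdeal.

Section Preimage.
Variables (R S : pzRingType) (phi : {rmorphism R -> S}) (I : ideal S).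

Lemma preim_zmod : zmod_closed (fun x => phi x \in I).
Proof.
split; first by rewrite unfold_in rmorph0 rpred0.
by move=> x y xI yI; rewrite unfold_in rmorphB rpredB.
Qed.
Lemma preim_mull a x : x \in (fun x => phi x \in I) -> a * x \in (fun x => phi x \in I).
Proof. by move=> xI; rewrite unfold_in rmorphM ideal_mull. Qed.
Lemma preim_mulr a x : x \in (fun x => phi x \in I) -> x * a \in (fun x => phi x \in I).
Proof. by move=> xI; rewrite unfold_in rmorphM ideal_mulr. Qed.

Definition preim_ideal := mk_ideal preim_zmod preim_mull preim_mulr.

Lemma mem_preim_ideal x : (x \in preim_ideal) = (phi x \in I).
Proof. by []. Qed.

End Preimage.

Section CentralExtension.
Variables (R : comPzRingType) (A : pzRingType) (i : {rmorphism R -> A}).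
Hypothesis i_central : forall c x, i c * x = x * i c.
Variable J : ideal R.

Let S : A -> bool := fun x => `[< set_mull (i @` [set` J]) x >].

Lemma ext_zmod : zmod_closed S.
Proof.
split; first by apply/asboolP; exists [::]; rewrite ?big_nil.
move=> x y /asboolP[s hs ->] /asboolP[t ht ->]; apply/asboolP.
exists (s ++ [seq (- p.1, p.2) | p <- t]).
  move=> p; rewrite mem_cat => /orP[/hs//|/mapP[q /ht ? ->]//].
rewrite big_cat big_map -sumrN /=; congr (_ + _).
by apply: eq_bigr => p _; rewrite mulNr.
Qed.

Lemma ext_mull a x : x \in S -> a * x \in S.
Proof.
move=> /asboolP[s hs ->]; apply/asboolP; exists [seq (a * p.1, p.2) | p <- s].
  by move=> p /mapP[q /hs ? ->].
by rewrite big_map mulr_sumr; apply: eq_bigr => p _; rewrite mulrA.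
Qed.

Lemma ext_mulr a x : x \in S -> x * a \in S.
Proof.
move=> /asboolP[s hs ->]; apply/asboolP; exists [seq (p.1 * a, p.2) | p <- s].
  by move=> p /mapP[q /hs ? ->].
rewrite big_map mulr_suml big_seq [RHS]big_seq; apply: eq_bigr => p /hs[c _ <-].
by rewrite -!mulrA i_central.
Qed.

(** The ideal A i(J); it is two-sided since the image of i is central. *)
Definition ext_ideal := mk_ideal ext_zmod ext_mull ext_mulr.

Lemma mem_ext_ideal x :
  reflect (set_mull (i @` [set` J]) x) (x \in ext_ideal).
Proof. by rewrite mem_mk_ideal; apply: asboolP. Qed.

Lemma ext_ideal_mulr : set_mulr (i @` [set` J]) = set_mull (i @` [set` J]).
Proof.
by apply/seteqP; split=> x [s hs ->]; exists [seq (p.2, p.1) | p <- s];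
  try (by move=> p /mapP[q /hs ? ->]); rewrite big_map big_seq [RHS]big_seq;
  apply: eq_bigr => p /hs[c _ <-]; rewrite i_central.
Qed.

Lemma ext_ideal_gen c : c \in J -> i c \in ext_ideal.
Proof.
move=> cJ; apply/mem_ext_ideal; exists [:: (1, i c)].
  by move=> p; rewrite inE => /eqP ->; exists c.
by rewrite big_seq1 mul1r.
Qed.

Lemma ext_ideal_min (P : A -> Prop) : P 0 ->
  (forall x y, P x -> P y -> P (x + y)) ->
  (forall a c, c \in J -> P (a * i c)) -> forall x, x \in ext_ideal -> P x.
Proof.
move=> P0 PD Pg x /mem_ext_ideal[s hs ->]; rewrite big_seq.
by elim/big_ind: _ => // p /hs[c cJ <-]; apply: Pg.
Qed.

End CentralExtension.

Section QuotientLift.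
Variables (R S : pzRingType) (J : ideal R) (phi : {rmorphism R -> S}).
Hypothesis phi0 : forall x, x \in J -> phi x = 0.

Let lift (q : quo J) : S := phi (repr q).

Lemma quo_lift_subproof x : lift (to_quo J x) = phi x.
Proof.
apply/eqP; rewrite -subr_eq0 -rmorphB; apply/eqP/phi0.
by apply/to_quoP; rewrite /to_quo reprK.
Qed.

Lemma quo_lift_zmod : zmod_morphism lift.
Proof.
elim/quoW=> x; elim/quoW=> y.
by rewrite -rmorphB !quo_lift_subproof rmorphB.
Qed.

Lemma quo_lift_monoid : monoid_morphism lift.
Proof.
split; first by rewrite -(rmorph1 (to_quo J)) quo_lift_subproof rmorph1.
elim/quoW=> x; elim/quoW=> y.
by rewrite -rmorphM !quo_lift_subproof rmorphM.
Qed.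

Definition quo_lift : {rmorphism quo J -> S} :=
  HB.pack lift (GRing.isZmodMorphism.Build _ _ lift quo_lift_zmod)
    (GRing.isMonoidMorphism.Build _ _ lift quo_lift_monoid).

Lemma quo_liftE x : quo_lift (to_quo J x) = phi x.
Proof. exact: quo_lift_subproof. Qed.

End QuotientLift.

Lemma to_quo_eq0 (R : pzRingType) (J : ideal R) x :
  (to_quo J x == 0) = (x \in J).
Proof. by rewrite -(rmorph0 (to_quo J)) -[in RHS](subr0 x); apply/eqP/to_quoP. Qed.

Lemma kp_family_image k (V : countType) (L : kgraph k V) (B B' : pzRingType)
    (phi : {rmorphism B -> B'}) (P : V -> B) (S SS : L -> B) :
  kp_family P S SS -> kp_family (phi \o P) (phi \o S) (phi \o SS).
Proof.
case=> h1 h2 h3 h4 h5 h6 h7; split=> /=.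
- by move=> v; rewrite h1.
- by move=> v; rewrite h2.
- by move=> v w; rewrite -rmorphM h3; case: eqP => // _; rewrite rmorph0.
- by move=> a b ab; rewrite -rmorphM h4.
- by move=> a b ab; rewrite -rmorphM h5.
- by move=> a b ab; rewrite -rmorphM h6 //; case: eqP => // _; rewrite rmorph0.
- move=> v n n0; rewrite (h7 v n n0) rmorph_sum.
  by apply: eq_bigr => a _; rewrite rmorphM.
Qed.

Section GroupAlgebraScalars.
Variables (K : comNzRingType) (H : zmodType).

Definition galg_scalar (r : K) : galg K H := << r *g 0 >>.

Lemma galg_scalar_zmod : zmod_morphism galg_scalar.
Proof. by move=> r t; rewrite /galg_scalar monalgUB. Qed.
HB.instance Definition _ :=
  GRing.isZmodMorphism.Build K (galg K H) galg_scalar galg_scalar_zmod.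
Lemma galg_scalar_monoid : monoid_morphism galg_scalar.
Proof.
by split=> // r t; rewrite -[RHS]/(galg_mul _ _) galg_mulUU addr0.
Qed.
HB.instance Definition _ :=
  GRing.isMonoidMorphism.Build K (galg K H) galg_scalar galg_scalar_monoid.

Definition galg_u (h : H) : galg K H := << 1 *g h >>.

Lemma galg_u0 : galg_u 0 = 1. Proof. by []. Qed.
Lemma galg_uD g h : galg_u (g + h) = galg_u g * galg_u h.
Proof. by rewrite -[RHS]/(galg_mul _ _) galg_mulUU mulr1. Qed.

Lemma galg_ZU r h : galg_scalar r * galg_u h = << r *g h >>.
Proof. by rewrite -[LHS]/(galg_mul _ _) galg_mulUU mulr1 add0r. Qed.

End GroupAlgebraScalars.

(** * The quotients of A as Kumjian-Pask algebras of G *)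

(** Send each basis vector to some preimage under f. *)
Lemma additive_section k l (f : {additive natvec k -> natvec l}) :
  (forall m, exists n, f n = m) ->
  exists g : {additive natvec l -> natvec k}, cancel g f.
Proof.
move=> f_surj; pose e (j : 'I_l) : natvec l := [ffun i => (i == j) : nat].
pose n j := projT1 (cid (f_surj (e j))).
have nE j : f (n j) = e j by rewrite /n; case: cid.
pose g (m : natvec l) := \sum_j n j *+ m j.
have g_nmod : nmod_morphism g.
  split; first by apply: big1 => j _; rewrite ffunE.
  by move=> x y; rewrite -big_split; apply: eq_bigr => j _; rewrite ffunE mulrnDr.
pose ga : {additive natvec l -> natvec k} :=
  HB.pack g (Algebra.isNmodMorphism.Build _ _ g g_nmod).
exists ga => m; rewrite /= /g raddf_sum; apply/ffunP => i.
rewrite sum_ffunE (bigD1 i) //= big1 => [|j /negbTE ij].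
  by rewrite raddfMn nE ffunMnE ffunE eqxx addr0 natn.
by rewrite raddfMn nE ffunMnE ffunE eq_sym ij mul0rn.
Qed.

Section Isomorphism.
Variables (K : fieldType) (k l : nat) (f : {additive natvec k -> natvec l}).
Variables (V : finType) (G : kgraph l V).
Hypothesis Gfin : row_finite G.
Variable g : {additive natvec l -> natvec k}.
Hypothesis gK : cancel g f.

Local Notation L := (pullback f G).
Local Notation A := (KP K L).
Local Notation H := (kerbar f).
Local Notation C := (galg K H).
Local Notation ps := (@pb_s K k l f V G).
Local Notation pss := (@pb_ss K k l f V G).
Local Notation iota := (@iota_rmorphism K k l f V G Gfin).

Implicit Types (a b : G) (n : natvec k).

(** The degree n differs from g (f n) by an element of the kernel; this is
    the power of u by which s_(a, n) differs from s_(a, g (f n)). *)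
Lemma defect_subproof n : in_ker f (vint n - vint (g (f n))).
Proof. by rewrite /in_ker fbarB gK subrr. Qed.
Definition defect n : H := exist (@in_ker k l f) _ (defect_subproof n).

Lemma defectD m n : defect (m + n) = defect m + defect n.
Proof.
by apply: val_inj; rewrite /= !raddfD !vintD opprD addrACA.
Qed.

Lemma defect_g m : defect (g m) = 0.
Proof. by apply: val_inj; rewrite /= gK subrr. Qed.

Lemma defect0 : defect 0 = 0.
Proof. by rewrite -(raddf0 g) defect_g. Qed.

Lemma UkerE_defect n : Uker K G (defect n) = twist K f G n (g (f n)).
Proof. exact: UkerE. Qed.

Section Quotient.
Variable J : ideal C.
Local Notation B := (KP (quo J) G).

Definition ubar (h : H) : quo J := to_quo J (galg_u K h).

Lemma ubarD h h' : ubar (h + h') = ubar h * ubar h'.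
Proof. by rewrite /ubar galg_uD rmorphM. Qed.
Lemma ubar0 : ubar 0 = 1. Proof. by rewrite /ubar galg_u0 rmorph1. Qed.
Lemma ubarN h : ubar h * ubar (- h) = 1.
Proof. by rewrite -ubarD subrr ubar0. Qed.

Definition theta_p (v : V) : B := kp_p G v.
Definition theta_s (x : L) : B := ubar (defect (deg x)) *: kp_s (val x).1.
Definition theta_ss (x : L) : B := ubar (- defect (deg x)) *: kp_ss (val x).1.

Lemma theta_family : kp_family theta_p theta_s theta_ss.
Proof.
have xy' (x y : L) : src x = rng y -> (src (val x).1 == rng (val y).1) = true.
  by move=> e; apply/eqP.
split.
- by move=> v; rewrite /theta_s deg_idm defect0 ubar0 scale1r; apply: kp_idm.
- by move=> v; rewrite /theta_ss deg_idm defect0 oppr0 ubar0 scale1r; apply: kp_gidm.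
- by move=> v w; rewrite kp_pp.
- move=> x y xy; rewrite /theta_s kp_mulZZ kp_sM xy' // -ubarD -defectD.
  by rewrite deg_comp // val_pullback_comp.
- move=> x y xy; rewrite /theta_ss kp_mulZZ kp_ssM xy' // -ubarD -opprD.
  by rewrite addrC -defectD deg_comp // val_pullback_comp // addrC.
- move=> x y dxy; rewrite /theta_s /theta_ss kp_mulZZ dxy mulrC ubarN scale1r.
  rewrite kp_sss ?deg_pullback ?dxy //.
  case: eqP => [e|ne]; first by rewrite (pullback_inj e dxy) eqxx.
  by case: eqP => // e; case: ne; rewrite e.
- move=> v n n0; rewrite /theta_p (kp_sum _ Gfin v (f n)) -sum_pullback //.
  apply: eq_bigr => x _; rewrite /theta_s /theta_ss kp_mulZZ.
  by rewrite ubarN scale1r.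
Qed.

(** The morphism from KP of the pullback over K to KP of G over C / J. It
    forgets the part of the degree that f does not see, and records it in a
    coefficient u_h. *)
Definition theta : {rmorphism A -> B} :=
  @kp_lift K k V L B
    (@kp_scalar (quo J) l V G \o to_quo J \o @galg_scalar K H)
    theta_p theta_s theta_ss (fun r x => kp_scalar_central _ x) theta_family
    erefl.

Lemma theta_scale r x :
  theta (r *: x) = to_quo J (galg_scalar H r) *: theta x.
Proof. by rewrite kp_lift_scale /= kp_scalarM. Qed.

Lemma theta_kp_p v : theta (kp_p L v) = kp_p G v.
Proof. exact: kp_lift_p. Qed.
Lemma theta_kp_s x : theta (kp_s x) = ubar (defect (deg x)) *: kp_s (val x).1.
Proof. exact: kp_lift_s. Qed.
Lemma theta_kp_ss x :
  theta (kp_ss x) = ubar (- defect (deg x)) *: kp_ss (val x).1.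
Proof. exact: kp_lift_ss. Qed.

(* From here on only the values on generators matter. *)
Opaque theta.

Lemma theta_pb_s a n : deg a = f n -> theta (ps a n) = ubar (defect n) *: kp_s a.
Proof.
by move=> /pullback_lift[x [<- <-]]; rewrite pb_sE theta_kp_s.
Qed.

Lemma theta_pb_ss a n :
  deg a = f n -> theta (pss a n) = ubar (- defect n) *: kp_ss a.
Proof.
by move=> /pullback_lift[x [<- <-]]; rewrite pb_ssE theta_kp_ss.
Qed.

Lemma theta_Uker h : theta (Uker K G h) = kp_scalar G (ubar h).
Proof.
rewrite Uker_posneg // /twist rmorph_sum /=.
rewrite -[RHS]mulr1 -(kp_unit_sum (quo J) Gfin (f (vpos (val h)))) mulr_sumr.
rewrite big_seq [RHS]big_seq; apply: eq_bigr => a.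
rewrite mem_degpaths // => /eqP da.
rewrite rmorphM /= theta_pb_s // theta_pb_ss -?kerbar_eq //.
rewrite kp_mulZZ kp_scalarM -ubarD.
suff -> : defect (vpos (val h)) - defect (vneg (val h)) = h by [].
apply: val_inj; rewrite /= kerbar_eq [RHS]vposnegE.
by rewrite opprB addrA subrK.
Qed.

Lemma theta_iota c : theta (iota c) = kp_scalar G (to_quo J c).
Proof.
rewrite [in RHS](monalgE c) rmorph_sum [in RHS]rmorph_sum /=.
rewrite /iota_gal rmorph_sum; apply: eq_bigr => h _ /=.
rewrite theta_scale theta_Uker -galg_ZU [in RHS]rmorphM /=.
by rewrite [in RHS]rmorphM [RHS]kp_scalarM.
Qed.

Local Notation E := (@ext_ideal C A iota (iota_central Gfin) J).

Lemma theta_ext x : x \in E -> theta x = 0.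
Proof.
apply: (ext_ideal_min (P := fun x => theta x = 0)) => [|y z hy hz|a c cJ].
  exact: rmorph0.
  by rewrite rmorphD /= hy hz addr0.
rewrite rmorphM /= theta_iota; have /eqP -> : to_quo J c == 0.
  by rewrite to_quo_eq0.
by rewrite rmorph0 mulr0.
Qed.

(** The section g lifts paths of G to paths of the pullback, functorially. *)
Definition psi_s a : A := ps a (g (deg a)).
Definition psi_ss a : A := pss a (g (deg a)).

Lemma psi_family0 : kp_family (fun v => kp_p L v : A) psi_s psi_ss.
Proof.
split.
- by move=> v; rewrite /psi_s deg_idm raddf0 pb_idm.
- by move=> v; rewrite /psi_ss deg_idm raddf0 pb_gidm.
- exact: kp_pp.
- by move=> a b ab; rewrite /psi_s pb_sM ?gK // ab eqxx deg_comp // raddfD.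
- by move=> a b ab; rewrite /psi_ss pb_ssM ?gK // ab eqxx deg_comp // raddfD.
- by move=> a b ab; rewrite /psi_s /psi_ss ab pb_sss ?gK.
- move=> v n _; rewrite -(pb_sum K f Gfin v (g n)) gK big_seq [RHS]big_seq.
  by apply: eq_bigr => a; rewrite mem_paths // => /andP[_ /eqP <-].
Qed.

Lemma iota_to_quo_eq0 c : c \in J -> (to_quo E \o iota) c = 0.
Proof.
move=> cJ; apply/eqP; rewrite /= to_quo_eq0.
exact: ext_ideal_gen.
Qed.

Definition psi_sc : {rmorphism quo J -> quo E} := quo_lift iota_to_quo_eq0.

Lemma psi_scE c : psi_sc (to_quo J c) = to_quo E (iota c).
Proof. exact: quo_liftE. Qed.

Lemma psi_sc_central r x : psi_sc r * x = x * psi_sc r.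
Proof.
elim/quoW: r => c; elim/quoW: x => x.
by rewrite psi_scE -!rmorphM /= iota_central.
Qed.

Lemma psi_sum1 : \sum_v (to_quo E \o (fun v => kp_p L v : A)) v = 1.
Proof. by rewrite -rmorph_sum rmorph1. Qed.

(** The inverse of theta modulo A iota(J): there the quotient ring C / J acts
    through iota. *)
Definition psi : {rmorphism B -> quo E} :=
  kp_lift psi_sc_central (kp_family_image (to_quo E) psi_family0) psi_sum1.

Lemma psi_kp_p v : psi (kp_p G v) = to_quo E (kp_p L v).
Proof. exact: kp_lift_p. Qed.
Lemma psi_kp_s a : psi (kp_s a) = to_quo E (psi_s a).
Proof. exact: kp_lift_s. Qed.
Lemma psi_kp_ss a : psi (kp_ss a) = to_quo E (psi_ss a).
Proof. exact: kp_lift_ss. Qed.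
Lemma psi_scale c y : psi (to_quo J c *: y) = to_quo E (iota c) * psi y.
Proof. by rewrite kp_lift_scale psi_scE. Qed.

Opaque psi.

(** The twist by n - g (f n) turns s_(a, g (f n)) into s_(a, n). *)
Lemma psi_theta x : psi (theta x) = to_quo E x.
Proof.
elim/kp_ind: x => [v|x|x||x y IHx IHy|x IHx|r x IHx|x y IHx IHy].
- by rewrite theta_kp_p psi_kp_p.
- rewrite theta_kp_s psi_scale psi_kp_s -rmorphM /=.
  rewrite iota_mkU // scale1r UkerE_defect /psi_s deg_pullback.
  by rewrite twist_s ?gK // ?deg_pullback // pb_sE.
- rewrite theta_kp_ss psi_scale psi_kp_ss -rmorphM /=.
  rewrite iota_mkU // scale1r /psi_ss deg_pullback.
  rewrite (@UkerE _ _ _ _ _ _ _ _ (g (f (deg x))) (deg x)) //=.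
    by rewrite twist_central ?gK // ss_twist ?gK ?deg_pullback // pb_ssE.
  by rewrite opprB.
- by rewrite !rmorph0.
- by rewrite !rmorphD /= IHx IHy.
- by rewrite !rmorphN /= IHx.
- rewrite theta_scale psi_scale IHx -rmorphM /= iota_mkU //.
  by rewrite Uker0 // kp_mulZl mul1r.
- by rewrite !rmorphM /= IHx IHy.
Qed.

Definition phi : {rmorphism quo E -> B} := quo_lift theta_ext.

Lemma phiE x : phi (to_quo E x) = theta x. Proof. exact: quo_liftE. Qed.

Opaque phi.

Lemma phiK : cancel phi psi.
Proof. by elim/quoW=> x; rewrite phiE psi_theta. Qed.

Lemma psiK : cancel psi phi.
Proof.
elim/kp_ind=> [v|a|a||x y IHx IHy|x IHx|r x IHx|x y IHx IHy].
- by rewrite psi_kp_p phiE theta_kp_p.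
- by rewrite psi_kp_s phiE theta_pb_s ?gK // defect_g ubar0 scale1r.
- by rewrite psi_kp_ss phiE theta_pb_ss ?gK // defect_g oppr0 ubar0 scale1r.
- by rewrite !rmorph0.
- by rewrite !rmorphD /= IHx IHy.
- by rewrite !rmorphN /= IHx.
- elim/quoW: r => c.
  by rewrite psi_scale rmorphM IHx phiE theta_iota kp_scalarM.
- by rewrite !rmorphM /= IHx IHy.
Qed.

Lemma theta_eq0 x : (theta x == 0) = (x \in E).
Proof.
apply/eqP/idP => [e|]; last exact: theta_ext.
by rewrite -to_quo_eq0 -psi_theta e rmorph0.
Qed.

Lemma theta_surj y : exists x, theta x = y.
Proof.
rewrite -[y]psiK; elim/quoW: (psi y) => x; by exists x; rewrite phiE.
Qed.

End Quotient.

Hypotheses (Gns : no_sources G) (V_nonempty : (0 < #|V|)%N).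

Definition ideal_of (J : ideal C) : ideal A :=
  @ext_ideal C A iota (iota_central Gfin) J.
Definition coef_ideal (I : ideal A) : ideal C := preim_ideal iota I.

Lemma kp_scalar_eq0 (R : comPzRingType) (r : R) : kp_scalar G r = 0 -> r = 0.
Proof.
move=> r0; have /card_gt0P[v _] := V_nonempty.
apply: (kp_pZ_eq0 Gfin Gns (v := v)).
by rewrite -kp_scalarM r0 mul0r.
Qed.

Lemma ideal_ofK : cancel ideal_of coef_ideal.
Proof.
move=> J; apply: ideal_eqP => c.
rewrite mem_preim_ideal /ideal_of -(theta_eq0 J) theta_iota -[RHS]to_quo_eq0.
by apply/eqP/eqP => [/kp_scalar_eq0//|->]; rewrite rmorph0.
Qed.

Hypotheses (Gcof : cofinal G) (Gap : aperiodic G).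

Lemma ideal_of_coef_sub I x : x \in ideal_of (coef_ideal I) -> x \in I.
Proof.
apply: (ext_ideal_min (P := fun x => x \in I)) => [|y z yI zI|a c cJ].
- exact: rpred0.
- exact: rpredD.
- exact: ideal_mull.
Qed.

(** Put J = iota^-1(I). If I were larger than A iota(J), its image in
    KP_(C/J)(G) would contain some non-zero multiple r p_v of a vertex, hence
    r 1 by cofinality. A representative c of r then has iota c in
    I + A iota(J) = I, so that c is in J and r = 0. *)
Lemma coef_idealK : cancel coef_ideal ideal_of.
Proof.
move=> I; apply: ideal_eqP => x; apply/idP/idP; first exact: ideal_of_coef_sub.
set J := coef_ideal I => xI; rewrite /ideal_of -(theta_eq0 J).
apply: contrapT => /negP/eqP tx0.
pose S y := exists2 z, z \in I & theta J z = y.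
have Sl y z : S z -> S (y * z).
  move=> [z' z'I <-]; have [y' <-] := theta_surj y.
  by exists (y' * z'); rewrite ?rmorphM // ideal_mull.
have Sr y z : S y -> S (y * z).
  move=> [y' y'I <-]; have [z' <-] := theta_surj z.
  by exists (y' * z'); rewrite ?rmorphM // ideal_mulr.
have SD y z : S y -> S z -> S (y + z).
  move=> [y' y'I <-] [z' z'I <-].
  by exists (y' + z'); rewrite ?rmorphD // rpredD.
have S0 : S 0 by exists 0; rewrite ?rmorph0 ?rpred0.
have Sx : S (theta J x) by exists x.
have [r [v [r0 Sv]]] := kp_uniqueness Gfin Gap Sl Sr Sx tx0.
have Sw := kp_cofinal Gfin Gcof S0 SD Sl Sr Sv.
have [z zI tz] : S (kp_scalar G r).
  rewrite /kp_scalar kp_1E scaler_sumr; elim/big_ind: _ => // w _; exact: Sw.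
elim/quoW: r r0 tz {Sv Sw} => c r0 tz; apply: r0.
apply/eqP; rewrite to_quo_eq0 mem_preim_ideal.
rewrite -[iota c](subrK z) rpredD // ideal_of_coef_sub //.
by rewrite /ideal_of -(theta_eq0 J) rmorphB theta_iota tz subrr.
Qed.

End Isomorphism.

(** * The lattice isomorphism *)

Section OrderIsomorphism.
Import Order.Theory.
Variables (d d' : Order.disp_t) (X : latticeType d) (Y : latticeType d').
Variables (F : X -> Y) (F' : Y -> X).
Hypotheses (FK : cancel F F') (F'K : cancel F' F).
Hypothesis (Fle : forall x y, (F x <= F y)%O = (x <= y)%O).

(** Meets and joins are determined by the order. *)
Lemma order_iso_meet x y : F (x `&` y)%O = (F x `&` F y)%O.
Proof.
apply: le_anti; rewrite lexI !Fle leIl leIr /=.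
by rewrite -[X in (X <= _)%O]F'K Fle lexI -!Fle F'K leIl leIr.
Qed.

Lemma order_iso_join x y : F (x `|` y)%O = (F x `|` F y)%O.
Proof.
apply: le_anti; rewrite leUx !Fle leUl leUr !andbT.
by rewrite -[X in (_ <= X)%O]F'K Fle leUx -!Fle F'K leUl leUr.
Qed.

End OrderIsomorphism.

Theorem theorem4p1 (K : fieldType) (k l : nat)
    (f : {additive natvec k -> natvec l}) (V : finType) (G : kgraph l V)
    (f_surj : forall m : natvec l, exists n : natvec k, f n = m)
    (G_row_finite : row_finite G) (G_no_sources : no_sources G)
    (V_nonempty : (0 < #|V|)%N)
    (G_cofinal : cofinal G) (G_aperiodic : aperiodic G) :
  let A := KP K (pullback f G) in
  let C := galg K (kerbar f) in
  let iota : C -> A := iota_gal G in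
  exists (Phi : ideal C -> ideal A) (Psi : ideal A -> ideal C),
    (forall J : ideal C,
       [set` Phi J] = set_mull (iota @` [set` J]) /\
       [set` Phi J] = set_mulr (iota @` [set` J])) /\
    (forall I : ideal A,
       [set` Psi I] = iota @^-1` ([set` I] `&` range iota)) /\
    cancel Phi Psi /\ cancel Psi Phi /\
    (forall J1 J2 : ideal C, (Phi J1 <= Phi J2)%O = (J1 <= J2)%O) /\
    (forall J1 J2 : ideal C, Phi (J1 `&` J2)%O = (Phi J1 `&` Phi J2)%O) /\
    (forall J1 J2 : ideal C, Phi (J1 `|` J2)%O = (Phi J1 `|` Phi J2)%O) /\
    (forall J : ideal C, 1 \notin J ->
       exists phi : {rmorphism quo (Phi J) -> KP (quo J) G},
         bijective phi /\
         forall (c : C) (a : A),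
           phi (to_quo (Phi J) (iota c * a))
             = to_quo J c *: phi (to_quo (Phi J) a)).
Proof.
move=> A C iota.
have [g gK] := additive_section f_surj.
pose Phi := ideal_of (K := K) (f := f) G_row_finite.
pose Psi := coef_ideal (K := K) (f := f) G_row_finite.
have PhiK : cancel Phi Psi := ideal_ofK G_row_finite gK G_no_sources V_nonempty.
have PsiK : cancel Psi Phi := coef_idealK G_row_finite gK G_cofinal G_aperiodic.
have Phi_le J1 J2 : (Phi J1 <= Phi J2)%O = (J1 <= J2)%O.
  apply/asboolP/asboolP => [h c cJ|h].
    rewrite -(PhiK J2) mem_preim_ideal; apply: h.
    by rewrite -mem_preim_ideal -[preim_ideal _ _]/(Psi (Phi J1)) PhiK.
  apply: (ext_ideal_min (P := fun x => x \in Phi J2)) => [|y z yI zI|a c cJ].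
  - exact: rpred0.
  - exact: rpredD.
  by apply/ideal_mull/ext_ideal_gen/h.
have PhiE J : [set` Phi J] = set_mull (iota @` [set` J]).
  by apply/seteqP; split=> x h;
    [apply: (elimT (mem_ext_ideal _ _ _) h) | apply/mem_ext_ideal].
exists Phi, Psi; split; [|split; [|split; [|split; [|split; [|split; [|split]]]]]] => //.
- move=> J; rewrite PhiE; split=> //.
  by rewrite -(@ext_ideal_mulr C A (iota_rmorphism K f G_row_finite)
      (iota_central G_row_finite)).
- move=> I; apply/seteqP; split=> c /=; last by case.
  by move=> cI; split=> //; exists c.
- exact: order_iso_meet PsiK Phi_le.
- exact: order_iso_join PsiK Phi_le.
move=> J _; exists (phi G_row_finite gK J); split.
  by exists (psi G_row_finite gK J); [apply: phiK | apply: psiK].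
move=> c a; rewrite rmorphM [LHS]rmorphM -kp_scalarM; congr (_ * _).
by rewrite -(theta_iota G_row_finite gK); apply: phiE.
Qed.
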